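(* Let $D=\{z\in\mathbb{C}:|z|<1\}$, let $f(z)=\sum_{n=0}^{\infty}z^{2^n}$ for $z\in D$, and let $V=S(\mathbb{H})\subset\mathbb{C}$ be the image on $\mathbb{H}=\{w\in\mathbb{C}:\operatorname{Im} w>0\}$ of the function $S(w)=F(w)+G(w)$, where $F(w)=\sum_{n=0}^{\infty}e(2^n w)$ and $G(w)=\sum_{l=1}^{\infty}e\left(-\frac{1}{2^l}\right)\left(e\left(\frac{w}{2^l}\right)-1\right)$. Then, for every open disk $U\subset\mathbb{C}$ centered at $1$ and for every $v\in V$, the function $f$ assumes the value $v$ infinitely many times on $D\cap U$, i.e. there are infinitely many points $z\in D\cap U$ with $f(z)=v$.
   Context: Notation: $e(w)=\exp(2\pi i w)$ for $w\in\mathbb{C}$. The function $f$ is holomorphic on $D$, and $F(w)=f(e(w))$ is holomorphic on $\mathbb{H}$. The series $G$ converges uniformly on compact subsets of $\mathbb{C}$ and defines an entire function. Hence $S$ is holomorphic on $\mathbb{H}$. *)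

(* Defs.v *)
(* Stdlib reals with Coquelicot's complex numbers. *)
From Stdlib Require Import Reals List.
From Coquelicot Require Import Coquelicot.

Open Scope C_scope.

(* Coquelicot's [Series] is real-valued; this is the sum of a series of complex
   numbers, unspecified when the series diverges. *)
Definition CSeries (a : nat -> C) : C :=
  iota (T := C_CompleteNormedModule)
    (fun s => is_series (V := C_NormedModule) a s).

Lemma CSeries_unique (a : nat -> C) (s : C) :
  is_series (V := C_NormedModule) a s -> CSeries a = s.
Proof.
intros H.
exact (iota_filterlim_locally (V := C_CompleteNormedModule)
         (F := eventually) (sum_n a) s H).
Qed.

Definition Cexp (z : C) : C :=
  RtoC (exp (Re z)) * (RtoC (cos (Im z)) + Ci * RtoC (sin (Im z))).

Definition e (w : C) : C := Cexp (2 * RtoC PI * Ci * w).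

Definition upper_half_plane (w : C) : Prop := (0 < Im w)%R.

Definition unit_disk (z : C) : Prop := (Cmod z < 1)%R.

Definition open_disk (c : C) (r : R) (z : C) : Prop := (Cmod (z - c) < r)%R.

(* Meaningful only on [unit_disk], where the series converges. *)
Definition lacunary_f (z : C) : C := CSeries (fun n => z ^ (2 ^ n)).

(* Meaningful only on [upper_half_plane]. *)
Definition lacunary_F (w : C) : C := CSeries (fun n => e (2 ^ n * w)).

(* The sum starts at l = 1, hence the shift of index. *)
Definition lacunary_G (w : C) : C :=
  CSeries (fun k => let l := S k in
    e (- (1 / 2 ^ l)) * (e (w / 2 ^ l) - 1)).

Definition lacunary_S (w : C) : C := lacunary_F w + lacunary_G w.

Definition image_S (v : C) : Prop := exists w : C, upper_half_plane w /\ v = lacunary_S w.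

Definition infinite_set (A : C -> Prop) : Prop :=
  ~ exists s : list C, forall z : C, A z -> In z s.

(* Main.v *)
(* Since e(2^n w) only depends on w modulo 1 for n >= 0,
   F((w+a)/2^k) = F(w) + sum_{l<=k} e((w+a)/2^l) for every integer a. If a is congruent to
   -1 modulo 2^m and sum_{l<=k} e(a/2^l) is small, the right-hand side is within O(2^-m) of
   S(w), locally uniformly. Such a, with moreover a/2^k close to 0, are built from binary
   words: orbits of angle doubling that leave 0, turn around the cycle {1/3, 2/3} (each turn
   contributes e(1/3) + e(2/3) = -1) and return to 0 (where each step contributes 1). Doing n
   such excursions and n conjugate ones gives 2n Re g for the sum, which Dirichlet's theorem
   brings close to an integer, and integers are cancelled by extra turns.
   A Hurwitz-type argument then transfers the value v from S to F((w+a)/2^k): S - v does not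
   vanish on the boundary of a small square, so |F((w+a)/2^k) - v| has an interior minimum,
   which must be 0 by Argand's descent. The descent requires only that F and S be nowhere
   locally constant, and this is read off the Taylor coefficients, which up to a factor are
   sums of 2^(nj) e(2^n w) over n, dominated by a single term for suitable large j. *)
Require Import Defs.
From Stdlib Require Import Reals List Lra Lia ZArith Classical ClassicalEpsilon FunctionalExtensionality.
From Coquelicot Require Import Coquelicot.

Open Scope C_scope.

(** * The complex exponential and finite and infinite sums *)

Lemma Cmod_sqr (z : C) : (Cmod z * Cmod z = Re z * Re z + Im z * Im z)%R.
Proof.
  generalize (Cmod2_alt z); simpl; lra.
Qed.

Lemma Ceq_ReIm (z w : C) : Re z = Re w -> Im z = Im w -> z = w.
Proof.
  destruct z, w; simpl; intros -> ->; reflexivity.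
Qed.

Lemma im_le_Cmod (z : C) : (Rabs (Im z) <= Cmod z)%R.
Proof.
  apply Rsqr_incr_0_var; [|apply Cmod_ge_0].
  rewrite <- Rsqr_abs; unfold Rsqr; rewrite Cmod_sqr; nra.
Qed.

Lemma Cmod_le_abs (z : C) : (Cmod z <= Rabs (Re z) + Rabs (Im z))%R.
Proof.
  pose proof (Rabs_pos (Re z)); pose proof (Rabs_pos (Im z)).
  apply Rsqr_incr_0_var; [|lra].
  unfold Rsqr; rewrite Cmod_sqr.
  generalize (Rsqr_abs (Re z)) (Rsqr_abs (Im z)); unfold Rsqr; nra.
Qed.

Lemma Cmod_triangle_sub (z w : C) : (Cmod (z - w) <= Cmod z + Cmod w)%R.
Proof.
  unfold Cminus; eapply Rle_trans; [apply Cmod_triangle|].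
  rewrite Cmod_opp; lra.
Qed.

Lemma Cmod_sub_sym (z w : C) : Cmod (z - w) = Cmod (w - z).
Proof.
  rewrite <- Cmod_opp; f_equal; ring.
Qed.

Lemma Cmod_triangle_mid (x y z : C) : (Cmod (x - z) <= Cmod (x - y) + Cmod (y - z))%R.
Proof.
  replace (x - z) with ((x - y) + (y - z)) by ring; apply Cmod_triangle.
Qed.

Lemma Cexp_ReIm (z : C) : Re (Cexp z) = (exp (Re z) * cos (Im z))%R /\ Im (Cexp z) = (exp (Re z) * sin (Im z))%R.
Proof.
  unfold Cexp; rewrite re_scal_l, im_scal_l, re_plus, im_plus.
  destruct z; simpl; split; ring.
Qed.

Lemma Cexp_plus (z w : C) : Cexp (z + w) = Cexp z * Cexp w.
Proof.
  destruct (Cexp_ReIm z) as [Hz1 Hz2], (Cexp_ReIm w) as [Hw1 Hw2],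
    (Cexp_ReIm (z + w)) as [H1 H2].
  apply Ceq_ReIm; [rewrite re_mult|rewrite im_mult];
    rewrite ?H1, ?H2, Hz1, Hz2, Hw1, Hw2, re_plus, im_plus, exp_plus, ?cos_plus, ?sin_plus; ring.
Qed.

Lemma Cexp_0 : Cexp 0 = 1.
Proof.
  unfold Cexp; simpl; rewrite exp_0, cos_0, sin_0; ring.
Qed.

Lemma Cmod_Cexp (z : C) : Cmod (Cexp z) = exp (Re z).
Proof.
  pose proof (exp_pos (Re z)).
  apply Rsqr_inj; [apply Cmod_ge_0|lra|].
  unfold Rsqr; rewrite Cmod_sqr; destruct (Cexp_ReIm z) as [-> ->].
  generalize (sin2_cos2 (Im z)); unfold Rsqr; intros E.
  transitivity (exp (Re z) * exp (Re z) * (sin (Im z) * sin (Im z) + cos (Im z) * cos (Im z)))%R; [ring|].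
  rewrite E; ring.
Qed.

(** Coordinates are differentiated separately, so that [auto_derive] and the real mean value theorem
    apply to complex-valued paths. *)
Definition has_deriv (phi : R -> C) (t : R) (l : C) : Prop :=
  is_derive (fun s => Re (phi s)) t (Re l) /\ is_derive (fun s => Im (phi s)) t (Im l).

(** Mean value inequality for paths in the plane. Projecting on the direction of the total increment
    [D] reduces it to the real mean value theorem for Re (conj D phi) - |D| psi, whose derivative is
    at most 0 by Cauchy-Schwarz. *)
Lemma increment_bound (phi dphi : R -> C) (psi dpsi : R -> R) :
  (forall t, 0 <= t <= 1 -> has_deriv phi t (dphi t))%R ->
  (forall t, 0 <= t <= 1 -> is_derive psi t (dpsi t))%R ->
  (forall t, 0 <= t <= 1 -> Cmod (dphi t) <= dpsi t)%R ->
  (Cmod (phi 1%R - phi 0%R) <= psi 1 - psi 0)%R.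
Proof.
  intros Hphi Hpsi Hle.
  set (D := phi 1%R - phi 0%R).
  set (f := fun t : R => (Re D * Re (phi t) + Im D * Im (phi t) - Cmod D * psi t)%R).
  set (df := fun t : R => (Re D * Re (dphi t) + Im D * Im (dphi t) - Cmod D * dpsi t)%R).
  assert (Hd : forall t, (0 <= t <= 1)%R -> is_derive f t (df t)).
  { intros t Ht; unfold f, df.
    destruct (Hphi t Ht) as [H1 H2].
    apply (is_derive_minus (K := R_AbsRing) (V := R_NormedModule)).
    - apply (is_derive_plus (K := R_AbsRing) (V := R_NormedModule));
        apply is_derive_scal; assumption.
    - apply is_derive_scal, Hpsi, Ht. }
  destruct (MVT_gen f 0 1 df) as [c [Hc Ec]].
  - rewrite Rmin_left, Rmax_right by lra; intros x Hx; apply Hd; lra.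
  - rewrite Rmin_left, Rmax_right by lra; intros x Hx.
    apply continuity_pt_filterlim, (ex_derive_continuous (K := R_AbsRing) (V := R_NormedModule)).
    exists (df x); apply Hd; lra.
  - rewrite Rmin_left, Rmax_right in Hc by lra.
    assert (Hneg : (df c <= 0)%R).
    { unfold df.
      assert (Re D * Re (dphi c) + Im D * Im (dphi c) <= Cmod D * Cmod (dphi c))%R.
      { rewrite <- Cmod_mult.
        replace (Re D * Re (dphi c) + Im D * Im (dphi c))%R with (Re (Cconj D * dphi c))
          by (rewrite re_mult, re_conj, im_conj; ring).
        rewrite Cmod_mult, <- (Cmod_conj D), <- Cmod_mult.
        eapply Rle_trans; [apply Rle_abs|apply re_le_Cmod]. }
      pose proof (Cmod_ge_0 D); specialize (Hle c Hc); nra. }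
    unfold f in Ec; ring_simplify in Ec.
    assert (E : (Cmod D * Cmod D - Cmod D * (psi 1 - psi 0) = df c)%R).
    { rewrite Cmod_sqr.
      replace (Re D) with (Re (phi 1%R) - Re (phi 0%R))%R in * by
        (unfold D, Cminus; rewrite re_plus, re_opp; ring).
      replace (Im D) with (Im (phi 1%R) - Im (phi 0%R))%R in * by
        (unfold D, Cminus; rewrite im_plus, im_opp; ring).
      lra. }
    pose proof (Cmod_ge_0 D) as H0.
    destruct (Req_dec (Cmod D) 0) as [E0|E0].
    (* When [D] vanishes there is no |D| to divide by. What is left is that [psi] does not decrease,
       since [dpsi] dominates a modulus. *)
    + rewrite E0.
      assert (0 <= dpsi c)%R by (eapply Rle_trans; [apply Cmod_ge_0|apply Hle, Hc]).
      destruct (MVT_gen psi 0 1 dpsi) as [c' [Hc' Ec']].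
      * rewrite Rmin_left, Rmax_right by lra; intros x Hx; apply Hpsi; lra.
      * rewrite Rmin_left, Rmax_right by lra; intros x Hx.
        apply continuity_pt_filterlim, (ex_derive_continuous (K := R_AbsRing) (V := R_NormedModule)).
        exists (dpsi x); apply Hpsi; lra.
      * rewrite Rmin_left, Rmax_right in Hc' by lra.
        specialize (Hle c' Hc'); pose proof (Cmod_ge_0 (dphi c')); nra.
    + nra.
Qed.

Lemma has_deriv_Cexp (z0 z1 : C) (t : R) :
  has_deriv (fun s => Cexp (z0 + RtoC s * z1)) t (z1 * Cexp (z0 + RtoC t * z1)).
Proof.
  split.
  - apply (is_derive_ext (fun s : R => (exp (Re z0 + s * Re z1) * cos (Im z0 + s * Im z1)))%R).
    { intros s; destruct (Cexp_ReIm (z0 + RtoC s * z1)) as [-> _].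
      now rewrite re_plus, im_plus, re_scal_l, im_scal_l. }
    rewrite re_mult; destruct (Cexp_ReIm (z0 + RtoC t * z1)) as [-> ->].
    rewrite re_plus, im_plus, re_scal_l, im_scal_l.
    auto_derive; [exact I|ring].
  - apply (is_derive_ext (fun s : R => (exp (Re z0 + s * Re z1) * sin (Im z0 + s * Im z1)))%R).
    { intros s; destruct (Cexp_ReIm (z0 + RtoC s * z1)) as [_ ->].
      now rewrite re_plus, im_plus, re_scal_l, im_scal_l. }
    rewrite im_mult; destruct (Cexp_ReIm (z0 + RtoC t * z1)) as [-> ->].
    rewrite re_plus, im_plus, re_scal_l, im_scal_l.
    auto_derive; [exact I|ring].
Qed.

Lemma exp_mono (x y : R) : (x <= y -> exp x <= exp y)%R.
Proof.
  intros [H | ->]; [left; apply exp_increasing, H|right; reflexivity].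
Qed.

(** The segment from [z] to [w] stays in the closed left half-plane, where the exponential has
    modulus at most 1. *)
Lemma Cexp_Lipschitz (z w : C) :
  (Re z <= 0)%R -> (Re w <= 0)%R -> (Cmod (Cexp w - Cexp z) <= Cmod (w - z))%R.
Proof.
  intros Hz Hw.
  pose proof (increment_bound (fun s => Cexp (z + RtoC s * (w - z)))
    (fun t => (w - z) * Cexp (z + RtoC t * (w - z)))
    (fun t => (Cmod (w - z) * t)%R) (fun _ => Cmod (w - z))) as H.
  cbv beta in H.
  replace (z + RtoC 1 * (w - z)) with w in H by ring.
  replace (z + RtoC 0 * (w - z)) with z in H by ring.
  replace (Cmod (w - z) * 1 - Cmod (w - z) * 0)%R with (Cmod (w - z)) in H by ring.
  apply H.
  - intros t _; apply has_deriv_Cexp.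
  - intros t _; auto_derive; [exact I|ring].
  - intros t Ht; rewrite Cmod_mult, Cmod_Cexp.
    rewrite <- (Rmult_1_r (Cmod (w - z))) at 2.
    apply Rmult_le_compat_l; [apply Cmod_ge_0|].
    rewrite <- exp_0; apply exp_mono.
    unfold Cminus; rewrite re_plus, re_scal_l, re_plus, re_opp; nra.
Qed.

(** * Finite sums, powers of one half and convergent series *)

Fixpoint csum (f : nat -> C) (n : nat) : C :=
  match n with O => 0 | S m => csum f m + f m end.

Lemma csum_ext (f g : nat -> C) (n : nat) :
  (forall i, (i < n)%nat -> f i = g i) -> csum f n = csum g n.
Proof.
  induction n as [|n IH]; simpl; intros H; [reflexivity|].
  rewrite IH, (H n) by (intros; try apply H; lia); reflexivity.
Qed.

Lemma csum_plus (f g : nat -> C) (n : nat) :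
  csum (fun i => f i + g i) n = csum f n + csum g n.
Proof.
  induction n as [|n IH]; simpl; [ring|rewrite IH; ring].
Qed.

Lemma csum_minus (f g : nat -> C) (n : nat) :
  csum (fun i => f i - g i) n = csum f n - csum g n.
Proof.
  induction n as [|n IH]; simpl; [ring|rewrite IH; ring].
Qed.

Lemma csum_scal (c : C) (f : nat -> C) (n : nat) :
  csum (fun i => c * f i) n = c * csum f n.
Proof.
  induction n as [|n IH]; simpl; [ring|rewrite IH; ring].
Qed.

Lemma csum_const (c : C) (n : nat) : csum (fun _ => c) n = RtoC (INR n) * c.
Proof.
  induction n as [|n IH]; [simpl; ring|].
  rewrite S_INR, RtoC_plus; simpl; rewrite IH; ring.
Qed.

Lemma csum_add (f : nat -> C) (n m : nat) :
  csum f (n + m) = csum f n + csum (fun i => f (n + i)%nat) m.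
Proof.
  induction m as [|m IH]; [rewrite Nat.add_0_r; simpl; ring|].
  rewrite Nat.add_succ_r; simpl; rewrite IH; ring.
Qed.

Lemma csum_S_l (f : nat -> C) (n : nat) :
  csum f (S n) = f O + csum (fun i => f (S i)) n.
Proof.
  change (S n) with (1 + n)%nat; rewrite csum_add; simpl; ring.
Qed.

Lemma csum_conj (f : nat -> C) (n : nat) :
  csum (fun i => Cconj (f i)) n = Cconj (csum f n).
Proof.
  induction n as [|n IH]; simpl.
  - apply Ceq_ReIm; simpl; ring.
  - rewrite IH, Cplus_conj; reflexivity.
Qed.

Lemma sum_n_csum (f : nat -> C) (n : nat) :
  sum_n (G := C_AbelianMonoid) f n = csum f (S n).
Proof.
  induction n as [|n IH].
  - rewrite sum_O; simpl; ring.
  - rewrite sum_Sn, IH; reflexivity.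
Qed.

Lemma pow_half_pos (n : nat) : (0 < / 2 ^ n)%R.
Proof. apply Rinv_0_lt_compat, pow_lt; lra. Qed.

Lemma pow_half_S (n : nat) : (/ 2 ^ S n = / 2 ^ n / 2)%R.
Proof. simpl; field; apply pow_nonzero; lra. Qed.

Lemma pow_half_le_1 (n : nat) : (/ 2 ^ n <= 1)%R.
Proof.
  induction n as [|n IH]; [simpl; lra|rewrite pow_half_S; generalize (pow_half_pos n); lra].
Qed.

Lemma pow_half_add (n m : nat) : (/ 2 ^ (n + m) = / 2 ^ n * / 2 ^ m)%R.
Proof. rewrite pow_add; field; split; apply pow_nonzero; lra. Qed.

Lemma pow_half_small (eps : R) : (0 < eps)%R -> exists N, forall n, (N <= n)%nat -> (/ 2 ^ n < eps)%R.
Proof.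
  intros He.
  destruct (pow_lt_1_zero (1/2) ltac:(rewrite Rabs_pos_eq; lra) eps He) as [N HN].
  exists N; intros n Hn; specialize (HN n Hn).
  replace (/ 2 ^ n)%R with ((1/2) ^ n)%R.
  - eapply Rle_lt_trans; [apply Rle_abs|apply HN].
  - unfold Rdiv; rewrite Rmult_1_l, pow_inv; reflexivity.
Qed.

(** The exact geometric sum is kept in the bound because the induction closes with it. *)
Lemma csum_half_bound (f : nat -> C) (A : R) (n : nat) :
  (forall i, (i < n)%nat -> Cmod (f i) <= A * / 2 ^ i)%R ->
  (Cmod (csum f n) <= 2 * A * (1 - / 2 ^ n))%R.
Proof.
  induction n as [|n IH]; intros H.
  - simpl; rewrite Cmod_0; lra.
  - simpl csum; eapply Rle_trans; [apply Cmod_triangle|].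
    assert (H1 := IH ltac:(intros; apply H; lia)); assert (H2 := H n ltac:(lia)).
    rewrite pow_half_S; lra.
Qed.

Lemma csum_half_bound_weak (f : nat -> C) (A : R) (n : nat) :
  (0 <= A)%R -> (forall i, (i < n)%nat -> Cmod (f i) <= A * / 2 ^ i)%R ->
  (Cmod (csum f n) <= 2 * A)%R.
Proof.
  intros HA H; eapply Rle_trans; [apply csum_half_bound, H|].
  generalize (pow_half_pos n); nra.
Qed.

Notation csums := (is_series (V := C_NormedModule)).

Lemma csums_csum (a : nat -> C) (s : C) (eps : R) : (0 < eps)%R ->
  csums a s -> exists N, forall n, (N <= n)%nat -> (Cmod (csum a n - s) < eps)%R.
Proof.
  intros He H.
  (* Balls in C are squares: an error below eps / 2 in each coordinate gives a modulus below eps. *)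
  assert (He2 : (0 < eps / 2)%R) by lra.
  destruct (H (ball s (mkposreal _ He2)) (locally_ball s (mkposreal _ He2))) as [N HN].
  (* [sum_n a n] includes the term of index n while [csum a n] stops before it, hence the shift by
     one. *)
  exists (S N); intros [|n] Hn; [lia|].
  specialize (HN n ltac:(lia)); rewrite sum_n_csum in HN.
  destruct HN as [H1 H2].
  eapply Rle_lt_trans; [apply Cmod_le_abs|].
  unfold Cminus; rewrite re_plus, im_plus, re_opp, im_opp.
  change (Rabs (Re (csum a (S n)) - Re s) < eps / 2)%R in H1.
  change (Rabs (Im (csum a (S n)) - Im s) < eps / 2)%R in H2.
  unfold Rminus in *; lra.
Qed.

Lemma csums_bound (a : nat -> C) (s : C) (B : R) :
  csums a s -> (forall n, Cmod (csum a n) <= B)%R -> (Cmod s <= B)%R.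
Proof.
  intros H HB; apply Rnot_lt_le; intros Hlt.
  destruct (csums_csum a s (Cmod s - B) ltac:(lra) H) as [N HN].
  specialize (HN N (le_n _)); specialize (HB N).
  rewrite Cmod_sub_sym in HN.
  pose proof (Cmod_triangle (s - csum a N) (csum a N)) as H1.
  replace (s - csum a N + csum a N) with s in H1 by ring; lra.
Qed.

Lemma csums_half_bound (a : nat -> C) (s : C) (A : R) :
  csums a s -> (forall i, Cmod (a i) <= A * / 2 ^ i)%R -> (Cmod s <= 2 * A)%R.
Proof.
  intros H HA; apply (csums_bound a); [assumption|].
  intros n; apply csum_half_bound_weak; [|intros; apply HA].
  generalize (HA O) (Cmod_ge_0 (a O)); simpl; lra.
Qed.

Lemma csums_ext (a b : nat -> C) (s : C) : (forall n, a n = b n) -> csums a s -> csums b s.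
Proof. apply is_series_ext. Qed.

Lemma csums_scal (c : C) (a : nat -> C) (s : C) :
  csums a s -> csums (fun n => c * a n) (c * s).
Proof. apply (is_series_scal (V := C_NormedModule)). Qed.

Lemma csums_minus (a b : nat -> C) (s t : C) :
  csums a s -> csums b t -> csums (fun n => a n - b n) (s - t).
Proof. apply (is_series_minus (V := C_NormedModule)). Qed.

Lemma csums_shift (a : nat -> C) (s : C) (N : nat) :
  csums a s -> csums (fun n => a (N + n)%nat) (s - csum a N).
Proof.
  intros H; destruct N as [|N].
  - simpl; replace (s - 0) with s by ring; exact H.
  - apply (is_series_incr_n (V := C_NormedModule)); [lia|].
    simpl pred; rewrite sum_n_csum.
    match goal with |- is_series _ ?x => replace x with s; [exact H|] end.
    change (s = s - csum a (S N) + csum a (S N)); ring.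
Qed.

Lemma ex_series_half (A : R) : ex_series (fun n => (A * / 2 ^ n)%R).
Proof.
  apply (ex_series_scal_l (V := R_NormedModule) A).
  apply (ex_series_ext (fun n => ((/ 2) ^ n)%R)).
  - intros n; apply pow_inv.
  - apply ex_series_geom; rewrite Rabs_pos_eq; lra.
Qed.

(** Comparison with a geometric series. This is how every [CSeries] of the development is shown to
    be a true sum rather than an unspecified value. *)
Lemma csums_half (a : nat -> C) (A : R) :
  (forall i, Cmod (a i) <= A * / 2 ^ i)%R -> csums a (CSeries a).
Proof.
  intros H.
  destruct (ex_series_le (V := C_CompleteNormedModule) a (fun n => (A * / 2 ^ n)%R)) as [s Hs].
  - intros n; exact (H n).
  - apply ex_series_half.
  - rewrite (CSeries_unique a s Hs); exact Hs.
Qed.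

(** * Taylor expansion of exponential sums *)

Lemma INR_fact_pos (n : nat) : (0 < INR (fact n))%R.
Proof. apply lt_0_INR, lt_O_fact. Qed.

Lemma has_deriv_plus (f g : R -> C) (t : R) (l m : C) :
  has_deriv f t l -> has_deriv g t m -> has_deriv (fun s => f s + g s) t (l + m).
Proof.
  intros [H1 H2] [H3 H4]; split;
    apply (is_derive_plus (K := R_AbsRing) (V := R_NormedModule)); assumption.
Qed.

Lemma has_deriv_opp (f : R -> C) (t : R) (l : C) :
  has_deriv f t l -> has_deriv (fun s => - f s) t (- l).
Proof.
  intros [H1 H2]; split;
    apply (is_derive_opp (K := R_AbsRing) (V := R_NormedModule)); assumption.
Qed.

Lemma has_deriv_pow (w : C) (n : nat) (t : R) :
  has_deriv (fun s => RtoC (s ^ n) * w) t (RtoC (INR n * t ^ pred n) * w).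
Proof.
  split.
  - apply (is_derive_ext (fun s => (s ^ n * Re w)%R)).
    { intros s; now rewrite re_scal_l. }
    rewrite re_scal_l; auto_derive; [exact I|ring].
  - apply (is_derive_ext (fun s => (s ^ n * Im w)%R)).
    { intros s; now rewrite im_scal_l. }
    rewrite im_scal_l; auto_derive; [exact I|ring].
Qed.

Definition exp_term (z : C) (j : nat) : C := z ^ j * RtoC (/ INR (fact j)).

Lemma exp_term_scal (t : R) (z : C) (j : nat) :
  exp_term (RtoC t * z) j = RtoC (t ^ j) * exp_term z j.
Proof. unfold exp_term; rewrite Cpow_mult_l, RtoC_pow; ring. Qed.

Lemma exp_term_deriv (z : C) (j : nat) (t : R) :
  has_deriv (fun s => exp_term (RtoC s * z) (S j)) t (z * exp_term (RtoC t * z) j).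
Proof.
  replace (z * exp_term (RtoC t * z) j) with
    (RtoC (INR (S j) * t ^ pred (S j)) * exp_term z (S j)).
  - destruct (has_deriv_pow (exp_term z (S j)) (S j) t) as [H1 H2].
    split; eapply is_derive_ext; try eassumption;
      intros s; cbv beta; now rewrite exp_term_scal.
  - rewrite exp_term_scal; unfold exp_term; simpl pred.
    rewrite RtoC_mult, Cpow_S.
    replace (RtoC (/ INR (fact j))) with (RtoC (INR (S j)) * RtoC (/ INR (fact (S j)))).
    + ring.
    + rewrite <- RtoC_mult; f_equal.
      change (fact (S j)) with (S j * fact j)%nat; rewrite mult_INR.
      field; split; [apply Rgt_not_eq, INR_fact_pos|apply not_0_INR; lia].
Qed.

Lemma exp_term_sum_deriv (z : C) (p : nat) (t : R) :
  has_deriv (fun s => csum (exp_term (RtoC s * z)) (S p)) t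
    (z * csum (exp_term (RtoC t * z)) p).
Proof.
  induction p as [|p IH].
  - assert (E : z * csum (exp_term (RtoC t * z)) 0 = RtoC 0) by (simpl; ring).
    rewrite E; split.
    + apply (is_derive_ext (fun _ => 1%R)); [intros s; simpl; field|].
      simpl; auto_derive; [exact I|ring].
    + apply (is_derive_ext (fun _ => 0%R)); [intros s; simpl; field|].
      simpl; auto_derive; [exact I|ring].
  - assert (E : z * csum (exp_term (RtoC t * z)) (S p) =
      z * csum (exp_term (RtoC t * z)) p + z * exp_term (RtoC t * z) p) by (simpl; ring).
    rewrite E; apply (has_deriv_plus (fun s => csum (exp_term (RtoC s * z)) (S p))
      (fun s => exp_term (RtoC s * z) (S p))); [exact IH|apply exp_term_deriv].
Qed.

(** Induction on the order along the segment from 0 to z: the derivative in t of the remainder of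
    order p + 1 at tz is z times the remainder of order p at tz. [increment_bound] then integrates
    the bound of order p, which produces the factor t^(p+1) / (p+1)!. *)
Lemma Cexp_Taylor (p : nat) (z : C) :
  (Cmod (Cexp z - csum (exp_term z) p) <= Cmod z ^ p / INR (fact p) * exp (Cmod z))%R.
Proof.
  revert z; induction p as [|p IH]; intros z.
  - simpl; replace (Cexp z - 0) with (Cexp z) by ring; rewrite Cmod_Cexp.
    replace (1 / 1 * exp (Cmod z))%R with (exp (Cmod z)) by field.
    apply exp_mono; eapply Rle_trans; [apply Rle_abs|apply re_le_Cmod].
  - pose proof (increment_bound
      (fun s => Cexp (0 + RtoC s * z) + - csum (exp_term (RtoC s * z)) (S p))
      (fun t => z * Cexp (0 + RtoC t * z) + - (z * csum (exp_term (RtoC t * z)) p))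
      (fun t => Cmod z ^ S p / INR (fact (S p)) * exp (Cmod z) * t ^ S p)%R
      (fun t => Cmod z ^ S p / INR (fact p) * exp (Cmod z) * t ^ p)%R) as H.
    cbv beta in H.
    replace (0 + RtoC 1 * z) with z in H by ring.
    replace (RtoC 1 * z) with z in H by ring.
    replace (0 + RtoC 0 * z) with (RtoC 0) in H by ring.
    replace (RtoC 0 * z) with (RtoC 0) in H by ring.
    assert (E0 : csum (exp_term 0) (S p) = 1).
    { rewrite csum_S_l, (csum_ext _ (fun _ => 0)), csum_const.
      - unfold exp_term; simpl; rewrite Rinv_1; ring.
      - intros i _; unfold exp_term; simpl; ring. }
    rewrite E0, Cexp_0, pow1, pow_i in H by lia.
    replace (Cexp z + - csum (exp_term z) (S p) - (1 + - (1)))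
      with (Cexp z - csum (exp_term z) (S p)) in H by ring.
    eapply Rle_trans; [apply H|right; ring].
    + intros t _; apply has_deriv_plus; [apply has_deriv_Cexp|].
      apply has_deriv_opp, exp_term_sum_deriv.
    + intros t _.
      replace (Cmod z ^ S p / INR (fact p) * exp (Cmod z) * t ^ p)%R with
        (Cmod z ^ S p / INR (fact (S p)) * exp (Cmod z) * (INR (S p) * t ^ p))%R.
      * generalize (Cmod z ^ S p / INR (fact (S p)) * exp (Cmod z))%R; intros K.
        auto_derive; [exact I|]; rewrite Rmult_1_l; reflexivity.
      * change (fact (S p)) with (S p * fact p)%nat; rewrite mult_INR.
        pose proof (INR_fact_pos p); assert (INR (S p) <> 0%R) by (apply not_0_INR; lia).
        field; split; [lra|assumption].
    + intros t Ht.
      replace (z * Cexp (0 + RtoC t * z) + - (z * csum (exp_term (RtoC t * z)) p)) with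
        (z * (Cexp (RtoC t * z) - csum (exp_term (RtoC t * z)) p))
        by (rewrite Cplus_0_l; ring).
      rewrite Cmod_mult.
      eapply Rle_trans; [apply Rmult_le_compat_l; [apply Cmod_ge_0|apply IH]|].
      rewrite Cmod_mult, Cmod_R, Rabs_pos_eq, Rpow_mult_distr by lra.
      assert (exp (t * Cmod z) <= exp (Cmod z))%R.
      { apply exp_mono; generalize (Cmod_ge_0 z); nra. }
      replace (Cmod z ^ S p / INR (fact p) * exp (Cmod z) * t ^ p)%R with
        (Cmod z * (t ^ p * Cmod z ^ p / INR (fact p) * exp (Cmod z)))%R
        by (simpl; field; apply Rgt_not_eq, INR_fact_pos).
      apply Rmult_le_compat_l; [apply Cmod_ge_0|].
      apply Rmult_le_compat_l; [|assumption].
      apply Rmult_le_pos; [apply Rmult_le_pos; apply pow_le; [lra|apply Cmod_ge_0]|].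
      left; apply Rinv_0_lt_compat, INR_fact_pos.
Qed.

Lemma exp_term_le_exp (x : R) (n : nat) : (0 <= x)%R -> (x ^ n / INR (fact n) <= exp x)%R.
Proof.
  intros Hx; eapply Rle_trans; [|apply (exp_ge_taylor x n Hx)].
  destruct n as [|n]; [simpl; lra|].
  rewrite tech5.
  assert (0 <= sum_f_R0 (fun k => (x ^ k / INR (fact k))%R) n)%R; [|lra].
  apply cond_pos_sum; intros k; apply Rmult_le_pos; [apply pow_le, Hx|].
  left; apply Rinv_0_lt_compat, INR_fact_pos.
Qed.

Lemma Cmod_exp_term (z : C) (j : nat) : Cmod (exp_term z j) = (Cmod z ^ j / INR (fact j))%R.
Proof.
  unfold exp_term; rewrite Cmod_mult, Cmod_pow, Cmod_R, Rabs_pos_eq; [reflexivity|].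
  left; apply Rinv_0_lt_compat, INR_fact_pos.
Qed.

(* Trading powers of the frequency for exponential decay. *)
Lemma pow_fact_le (l r : R) (p : nat) : (0 <= l -> 0 < r ->
  l ^ S p / INR (fact (S p)) <= l * (/ r) ^ p * exp (l * r))%R.
Proof.
  intros Hl Hr.
  assert (H1 : (l ^ p / INR (fact p) <= (/ r) ^ p * exp (l * r))%R).
  { replace (l ^ p / INR (fact p))%R with ((/ r) ^ p * ((l * r) ^ p / INR (fact p)))%R.
    - apply Rmult_le_compat_l; [apply pow_le; left; apply Rinv_0_lt_compat, Hr|].
      apply exp_term_le_exp; nra.
    - rewrite Rpow_mult_distr, pow_inv; field; split; [apply Rgt_not_eq, INR_fact_pos|].
      apply pow_nonzero; lra. }
  assert (H2 : (l ^ S p / INR (fact (S p)) <= l * (l ^ p / INR (fact p)))%R).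
  { change (fact (S p)) with (S p * fact p)%nat; rewrite mult_INR, S_INR.
    pose proof (pos_INR p); pose proof (INR_fact_pos p).
    replace (l ^ S p / ((INR p + 1) * INR (fact p)))%R with
      (l * (l ^ p / INR (fact p)) * / (INR p + 1))%R by (simpl; field; lra).
    rewrite <- (Rmult_1_r (l * (l ^ p / INR (fact p)))) at 2.
    apply Rmult_le_compat_l.
    - apply Rmult_le_pos; [lra|]; apply Rmult_le_pos; [apply pow_le, Hl|].
      left; apply Rinv_0_lt_compat; lra.
    - rewrite <- Rinv_1; apply Rinv_le_contravar; lra. }
  eapply Rle_trans; [exact H2|]; rewrite Rmult_assoc.
  apply Rmult_le_compat_l; assumption.
Qed.

(** The coefficient of h^j in a_n exp(i l_n h). Its sum over n is the Taylor coefficient of order j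
    of the exponential sum with frequencies l_n. *)
Definition freq_term (a : nat -> C) (l : nat -> R) (j n : nat) : C :=
  a n * exp_term (Ci * RtoC (l n)) j.

Lemma Cmod_Ci_RtoC (x : R) : (0 <= x)%R -> Cmod (Ci * RtoC x) = x.
Proof.
  intros Hx; rewrite Cmod_mult, Cmod_R, Rabs_pos_eq by assumption.
  replace (Cmod Ci) with 1%R; [ring|].
  unfold Cmod, Ci; simpl; rewrite <- sqrt_1 at 1; f_equal; ring.
Qed.

Lemma freq_term_sums (a : nat -> C) (l : nat -> R) (A r : R) (j : nat) :
  (0 < r)%R -> (forall n, 0 <= l n)%R ->
  (forall n, Cmod (a n) * l n * exp (l n * r) <= A * / 2 ^ n)%R ->
  csums (freq_term a l (S j)) (CSeries (freq_term a l (S j))).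
Proof.
  intros Hr Hl HA; apply (csums_half _ ((/ r) ^ j * A)); intros n.
  unfold freq_term; rewrite Cmod_mult, Cmod_exp_term, Cmod_Ci_RtoC by apply Hl.
  pose proof (pow_fact_le (l n) r j (Hl n) Hr) as H1.
  assert (0 < (/ r) ^ j)%R by (apply pow_lt, Rinv_0_lt_compat, Hr).
  eapply Rle_trans; [apply Rmult_le_compat_l; [apply Cmod_ge_0|exact H1]|].
  replace (Cmod (a n) * (l n * (/ r) ^ j * exp (l n * r)))%R with
    ((/ r) ^ j * (Cmod (a n) * l n * exp (l n * r)))%R by ring.
  rewrite (Rmult_assoc ((/ r) ^ j) A); apply Rmult_le_compat_l; [lra|apply HA].
Qed.

(** The Taylor formula for the exponential is summed term by term. Induction on p subtracts one
    coefficient series at a time, so that d minus the polynomial is the sum of the individual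
    remainders, and these have a geometric majorant. *)
Lemma exp_sum_expansion (a : nat -> C) (l : nat -> R) (A r : R) (p : nat) :
  (0 < r)%R -> (forall n, 0 <= l n)%R ->
  (forall n, Cmod (a n) * l n * exp (l n * r) <= A * / 2 ^ n)%R ->
  exists M, forall h d : C, (Cmod h <= r / 2)%R ->
    csums (fun n => a n * (Cexp (Ci * RtoC (l n) * h) - 1)) d ->
    (Cmod (d - csum (fun j => CSeries (freq_term a l (S j)) * h ^ S j)%C p)
      <= M * Cmod h ^ S p)%R.
Proof.
  intros Hr Hl HA; exists (2 * ((/ (r / 2)) ^ p * A))%R; intros h d Hh Hd.
  assert (HR : csums (fun n => a n * (Cexp (Ci * RtoC (l n) * h) -
      csum (exp_term (Ci * RtoC (l n) * h)) (S p)))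
    (d - csum (fun j => CSeries (freq_term a l (S j)) * h ^ S j) p)).
  { induction p as [|p IH].
    - simpl; replace (d - 0) with d by ring.
      apply (csums_ext (fun n => a n * (Cexp (Ci * RtoC (l n) * h) - 1))); [|exact Hd].
      intros n; unfold exp_term; simpl; rewrite Rinv_1; ring.
    - pose proof (csums_minus _ _ _ _ IH
        (csums_scal (h ^ S p) _ _ (freq_term_sums a l A r p Hr Hl HA))) as H.
      match type of H with is_series _ ?s =>
        replace (d - csum (fun j => CSeries (freq_term a l (S j)) * h ^ S j) (S p)) with s end.
      2: { change (csum (fun j => CSeries (freq_term a l (S j)) * h ^ S j) (S p)) with
        (csum (fun j => CSeries (freq_term a l (S j)) * h ^ S j) p +
         CSeries (freq_term a l (S p)) * h ^ S p); ring. }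
      eapply csums_ext; [|exact H].
      intros n; unfold freq_term.
      change (csum (exp_term (Ci * RtoC (l n) * h)) (S (S p))) with
        (csum (exp_term (Ci * RtoC (l n) * h)) (S p) + exp_term (Ci * RtoC (l n) * h) (S p)).
      replace (exp_term (Ci * RtoC (l n) * h) (S p)) with
        (h ^ S p * exp_term (Ci * RtoC (l n)) (S p)).
      + ring.
      + unfold exp_term; rewrite (Cpow_mult_l (Ci * RtoC (l n)) h); ring. }
  replace (2 * ((/ (r / 2)) ^ p * A) * Cmod h ^ S p)%R with
    (2 * (Cmod h ^ S p * ((/ (r / 2)) ^ p * A)))%R by ring.
  apply (csums_half_bound _ _ _ HR); intros n.
  rewrite Cmod_mult.
  eapply Rle_trans; [apply Rmult_le_compat_l; [apply Cmod_ge_0|apply Cexp_Taylor]|].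
  rewrite Cmod_mult, Cmod_Ci_RtoC, Rpow_mult_distr by apply Hl.
  pose proof (Cmod_ge_0 h); pose proof (Hl n).
  pose proof (pow_fact_le (l n) (r / 2) p (Hl n) ltac:(lra)) as H1.
  assert (H2 : (exp (l n * Cmod h) <= exp (l n * (r / 2)))%R) by (apply exp_mono; nra).
  (* The weight exp(l r) is split into two equal factors: one absorbs the powers of l, the other the
     factor exp(l |h|) of the Taylor remainder. *)
  assert (H3 : (exp (l n * r) = exp (l n * (r / 2)) * exp (l n * (r / 2)))%R).
  { rewrite <- exp_plus; f_equal; field. }
  specialize (HA n); rewrite H3 in HA.
  pose proof (exp_pos (l n * (r / 2))) as He.
  set (E := exp (l n * (r / 2))) in *; set (q := ((/ (r / 2)) ^ p)%R) in *.
  assert (Hq : (0 < q)%R) by (apply pow_lt, Rinv_0_lt_compat; lra).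
  assert (HP : (0 <= Cmod h ^ S p)%R) by (apply pow_le; lra).
  pose proof (Cmod_ge_0 (a n)) as Ha.
  apply Rle_trans with (Cmod (a n) * (l n * q * E * Cmod h ^ S p * E))%R.
  - apply Rmult_le_compat_l; [assumption|].
    apply Rmult_le_compat; [| left; apply exp_pos | | exact H2].
    + apply Rmult_le_pos; [apply Rmult_le_pos; apply pow_le; lra|].
      left; apply Rinv_0_lt_compat, INR_fact_pos.
    + unfold Rdiv; rewrite Rmult_assoc, (Rmult_comm (Cmod h ^ S p)), <- Rmult_assoc.
      apply Rmult_le_compat_r; assumption.
  - replace (Cmod (a n) * (l n * q * E * Cmod h ^ S p * E))%R with
      (Cmod h ^ S p * q * (Cmod (a n) * l n * (E * E)))%R by ring.
    replace (Cmod h ^ S p * (q * A) * / 2 ^ n)%R with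
      (Cmod h ^ S p * q * (A * / 2 ^ n))%R by ring.
    apply Rmult_le_compat_l; [apply Rmult_le_pos; lra|assumption].
Qed.

(** * Leading terms and Argand's descent *)

Lemma Cexp_pow (z : C) (n : nat) : Cexp z ^ n = Cexp (RtoC (INR n) * z).
Proof.
  induction n as [|n IH].
  - simpl; rewrite Cmult_0_l, Cexp_0; reflexivity.
  - rewrite Cpow_S, IH, <- Cexp_plus, S_INR, RtoC_plus; f_equal; ring.
Qed.

Lemma unit_polar (z : C) : Cmod z = 1%R -> exists theta : R, z = Cexp (Ci * RtoC theta).
Proof.
  intros Hz; pose proof (Cmod_sqr z) as H; rewrite Hz in H.
  assert (Hx : (-1 <= Re z <= 1)%R) by (split; nra).
  assert (Hs : sin (acos (Re z)) = Rabs (Im z)).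
  { rewrite sin_acos by assumption; rewrite <- sqrt_Rsqr_abs; f_equal; unfold Rsqr; lra. }
  assert (E : forall t, Re (Ci * RtoC t) = 0%R /\ Im (Ci * RtoC t) = t).
  { intros t; simpl; split; ring. }
  destruct (Rle_dec 0 (Im z)) as [Hy|Hy]; [exists (acos (Re z))|exists (- acos (Re z))%R];
    match goal with |- _ = Cexp (Ci * RtoC ?t) => destruct (E t) as [E1 E2] end;
    match goal with |- _ = Cexp ?w => destruct (Cexp_ReIm w) as [E3 E4] end;
    apply Ceq_ReIm; rewrite ?E3, ?E4, ?E1, ?E2, ?exp_0, ?cos_neg, ?sin_neg, ?cos_acos, ?Hs;
    try assumption; try ring.
  - rewrite Rabs_pos_eq by assumption; ring.
  - rewrite Rabs_left by lra; ring.
Qed.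

Lemma unit_root (z : C) (p : nat) : (1 <= p)%nat -> Cmod z = 1%R ->
  exists d : C, Cmod d = 1%R /\ d ^ p = z.
Proof.
  intros Hp Hz; destruct (unit_polar z Hz) as [t Ht].
  assert (Hp0 : INR p <> 0%R) by (apply not_0_INR; lia).
  exists (Cexp (Ci * RtoC (t / INR p))); split.
  - rewrite Cmod_Cexp; simpl; replace (0 * (t / INR p) - 1 * 0)%R with 0%R by ring; apply exp_0.
  - rewrite Cexp_pow, Ht; f_equal.
    replace (RtoC t) with (RtoC (INR p) * RtoC (t / INR p)); [ring|].
    rewrite <- RtoC_mult; f_equal; field; assumption.
Qed.

Definition leading_term (g : C -> C) (u : C) (p : nat) (c : C) : Prop :=
  exists M r, (0 <= M /\ 0 < r /\ forall h, Cmod h <= r ->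
    Cmod (g (u + h)%C - g u - c * h ^ p) <= M * Cmod h ^ S p)%R.

(** A substitute for being holomorphic and not constant near u: an expansion g(u) + c h^p +
    O(h^(p+1)) with c nonzero. It yields continuity at u, isolation of the value g(u) and Argand's
    descent. *)
Definition nonflat (g : C -> C) (u : C) : Prop :=
  exists (p : nat) (c : C), (1 <= p)%nat /\ c <> 0 /\ leading_term g u p c.

Lemma pow_le_self (t : R) (p : nat) : (0 <= t <= 1)%R -> (1 <= p)%nat -> (t ^ p <= t)%R.
Proof.
  intros Ht Hp; destruct p as [|p]; [lia|simpl].
  assert (0 <= t ^ p <= 1)%R.
  { split; [apply pow_le; lra|]; rewrite <- (pow1 p); apply pow_incr; lra. }
  nra.
Qed.

(** The first nonzero coefficient provides the leading term, and the expansion stopped just after it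
    provides the error bound. *)
Lemma nonflat_of_expansion (g : C -> C) (u : C) (c : nat -> C) :
  (forall p, exists M r, 0 < r /\ forall h, Cmod h <= r ->
    Cmod (g (u + h)%C - g u - csum (fun j => c j * h ^ S j)%C p) <= M * Cmod h ^ S p)%R ->
  (exists j, c j <> 0) -> nonflat g u.
Proof.
  intros Hexp [j Hj].
  assert (Hleast : exists k, c k <> 0 /\ forall i, (i < k)%nat -> c i = 0).
  { revert Hj; induction j as [j IH] using (well_founded_induction lt_wf); intros Hj.
    destruct (classic (exists i, (i < j)%nat /\ c i <> 0)) as [[i [Hi Hc]]|Hno].
    - exact (IH i Hi Hc).
    - exists j; split; [assumption|]; intros i Hi.
      apply NNPP; intros Hc; apply Hno; exists i; split; assumption. }
  destruct Hleast as [k [Hk Hlt]].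
  destruct (Hexp (S k)) as [M [r [Hr HM]]].
  exists (S k), (c k); split; [lia|]; split; [assumption|].
  (* The constant M comes without a sign, whereas [leading_term] asks for a nonnegative one. *)
  exists (Rmax M 0), r; split; [apply Rmax_r|]; split; [assumption|]; intros h Hh.
  eapply Rle_trans; [|eapply Rle_trans; [apply HM, Hh|]].
  - right; f_equal; f_equal.
    change (csum (fun j => c j * h ^ S j) (S k)) with
      (csum (fun j => c j * h ^ S j) k + c k * h ^ S k).
    rewrite (csum_ext _ (fun _ => 0)), csum_const; [ring|].
    intros i Hi; rewrite Hlt by lia; ring.
  - apply Rmult_le_compat_r; [apply pow_le, Cmod_ge_0|apply Rmax_l].
Qed.

Lemma nonflat_continuous (g : C -> C) (u : C) (eps : R) : nonflat g u -> (0 < eps)%R ->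
  exists delta, (0 < delta)%R /\ forall h : C, (Cmod h <= delta)%R -> (Cmod (g (u + h)%C - g u) < eps)%R.
Proof.
  intros [p [c [Hp [_ [M [r [HM [Hr H]]]]]]]] He.
  pose proof (Cmod_ge_0 c) as Hc.
  set (B := (Cmod c + M + 1)%R).
  assert (HB : (0 < B)%R) by (unfold B; lra).
  exists (Rmin r (Rmin 1 (eps / (2 * B)))); split.
  { repeat apply Rmin_glb_lt; try lra; apply Rdiv_lt_0_compat; lra. }
  intros h Hh.
  assert (Hh1 : (Cmod h <= r)%R) by (eapply Rle_trans; [apply Hh|apply Rmin_l]).
  assert (Hh2 : (Cmod h <= 1)%R).
  { eapply Rle_trans; [apply Hh|eapply Rle_trans; [apply Rmin_r|apply Rmin_l]]. }
  assert (Hh3 : (Cmod h <= eps / (2 * B))%R).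
  { eapply Rle_trans; [apply Hh|eapply Rle_trans; [apply Rmin_r|apply Rmin_r]]. }
  specialize (H h Hh1); pose proof (Cmod_ge_0 h) as Hh0.
  replace (g (u + h) - g u) with ((g (u + h) - g u - c * h ^ p) + c * h ^ p) by ring.
  eapply Rle_lt_trans; [apply Cmod_triangle|].
  rewrite Cmod_mult, Cmod_pow.
  pose proof (pow_le_self (Cmod h) p ltac:(lra) Hp).
  pose proof (pow_le_self (Cmod h) (S p) ltac:(lra) ltac:(lia)).
  apply Rle_lt_trans with (B * Cmod h)%R; [unfold B; nra|].
  apply Rle_lt_trans with (B * (eps / (2 * B)))%R; [apply Rmult_le_compat_l; lra|].
  replace (B * (eps / (2 * B)))%R with (eps / 2)%R by (field; lra); lra.
Qed.

(* Argand: at a point with a leading term of order [p], moving in a direction [d] with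
   [c d^p] opposite to [g u - v] decreases the modulus. *)
Lemma nonflat_descent (g : C -> C) (u v : C) (rho : R) :
  nonflat g u -> (0 < rho)%R -> g u <> v ->
  exists h : C, (Cmod h < rho)%R /\ (Cmod (g (u + h)%C - v) < Cmod (g u - v))%R.
Proof.
  intros [p [c [Hp [Hc [M [r [HM [Hr H]]]]]]]] Hrho Hv.
  set (b := g u - v).
  assert (Hb : b <> 0).
  { intros E; apply Hv; apply Ceq_minus, E. }
  assert (Hb0 : (0 < Cmod b)%R) by (apply Cmod_gt_0, Hb).
  assert (Hc0 : (0 < Cmod c)%R) by (apply Cmod_gt_0, Hc).
  destruct (unit_root (- (RtoC (Cmod c / Cmod b)) * b / c) p Hp) as [d [Hd Hdp]].
  { rewrite Cmod_div, Cmod_mult, Cmod_opp, Cmod_R by assumption.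
    rewrite Rabs_pos_eq by (apply Rlt_le, Rdiv_lt_0_compat; assumption).
    field; split; lra. }
  assert (Hcd : c * d ^ p = - RtoC (Cmod c / Cmod b) * b).
  { rewrite Hdp; field; assumption. }
  (* The bounds on t serve in turn to get t^p at most t, to stay within rho, to stay within the
     range of the expansion, to make the remainder M t^(p+1) smaller than the gain |c| t^p, and to
     keep the multiple of b nonnegative so that the move does not overshoot 0. *)
  set (t := Rmin (Rmin 1 (rho / 2)) (Rmin r (Rmin (Cmod c / (2 * (M + 1))) (Cmod b / Cmod c)))).
  assert (Ht : (0 < t)%R).
  { unfold t; repeat apply Rmin_glb_lt; try lra; apply Rdiv_lt_0_compat; lra. }
  assert (Ht1 : (t <= 1)%R) by (eapply Rle_trans; [apply Rmin_l|apply Rmin_l]).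
  assert (Ht2 : (t <= rho / 2)%R) by (eapply Rle_trans; [apply Rmin_l|apply Rmin_r]).
  assert (Ht3 : (t <= r)%R) by (eapply Rle_trans; [apply Rmin_r|apply Rmin_l]).
  assert (Ht4 : (t <= Cmod c / (2 * (M + 1)))%R).
  { eapply Rle_trans; [apply Rmin_r|]; eapply Rle_trans; [apply Rmin_r|apply Rmin_l]. }
  assert (Ht5 : (t <= Cmod b / Cmod c)%R).
  { eapply Rle_trans; [apply Rmin_r|]; eapply Rle_trans; [apply Rmin_r|apply Rmin_r]. }
  assert (Hm : Cmod (RtoC t * d) = t).
  { rewrite Cmod_mult, Cmod_R, Hd, Rabs_pos_eq by lra; ring. }
  exists (RtoC t * d); rewrite Hm; split; [lra|].
  specialize (H (RtoC t * d)); rewrite Hm in H; specialize (H Ht3).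
  rewrite Cpow_mult_l, <- RtoC_pow in H.
  replace (g (u + RtoC t * d) - v) with
    ((g (u + RtoC t * d) - g u - c * (RtoC (t ^ p) * d ^ p)) +
      RtoC (1 - t ^ p * (Cmod c / Cmod b)) * b).
  2: { replace (c * (RtoC (t ^ p) * d ^ p)) with (RtoC (t ^ p) * (c * d ^ p)) by ring.
       rewrite Hcd, RtoC_minus, (RtoC_mult (t ^ p)); unfold b; ring. }
  eapply Rle_lt_trans; [apply Cmod_triangle|].
  pose proof (pow_le_self t p ltac:(lra) Hp) as Htp.
  assert (Htp0 : (0 < t ^ p)%R) by (apply pow_lt, Ht).
  assert (Hk : (t ^ p * (Cmod c / Cmod b) <= 1)%R).
  { apply Rle_trans with (Cmod b / Cmod c * (Cmod c / Cmod b))%R.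
    - apply Rmult_le_compat_r; [apply Rlt_le, Rdiv_lt_0_compat; assumption|lra].
    - right; field; lra. }
  rewrite Cmod_mult, Cmod_R, Rabs_pos_eq by lra.
  replace ((1 - t ^ p * (Cmod c / Cmod b)) * Cmod b)%R with (Cmod b - t ^ p * Cmod c)%R
    by (field; lra).
  fold b.
  assert (Hs : (M * t < Cmod c)%R).
  { apply Rle_lt_trans with ((M + 1) * (Cmod c / (2 * (M + 1))))%R; [nra|].
    replace ((M + 1) * (Cmod c / (2 * (M + 1))))%R with (Cmod c / 2)%R by (field; lra); lra. }
  simpl pow in H; nra.
Qed.

(** If the infimum -m were not attained, each point would have a neighborhood on which phi exceeds
    -m by a fixed gap. Compactness makes the gap uniform, which contradicts the definition of the
    infimum. *)
Lemma lsc_min_rectangle (phi : R -> R -> R) (a b a' b' : R) :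
  (a <= b)%R -> (a' <= b')%R -> (forall x y, 0 <= phi x y)%R ->
  (forall x y eps, a <= x <= b -> a' <= y <= b' -> 0 < eps ->
    exists delta, 0 < delta /\ forall s t, Rabs (s - x) < delta -> Rabs (t - y) < delta ->
      phi x y - eps < phi s t)%R ->
  exists x y, (a <= x <= b /\ a' <= y <= b' /\
    forall s t, a <= s <= b -> a' <= t <= b' -> phi x y <= phi s t)%R.
Proof.
  intros Hab Hab' Hpos Hlsc.
  (* [completeness] yields suprema, so the values are negated. *)
  set (E := fun z : R => exists x y, (a <= x <= b /\ a' <= y <= b' /\ z = - phi x y)%R).
  destruct (completeness E) as [m [Hub Hlub]].
  { exists 0%R; intros z [x [y [_ [_ ->]]]]; specialize (Hpos x y); lra. }
  { exists (- phi a a')%R, a, a'; repeat split; lra. }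
  apply NNPP; intros Hno.
  assert (Hgt : forall x y, (a <= x <= b -> a' <= y <= b' -> - m < phi x y)%R).
  { intros x y Hx Hy.
    assert (H1 : (- phi x y <= m)%R) by (apply Hub; exists x, y; auto).
    destruct H1 as [H1|H1]; [lra|].
    exfalso; apply Hno; exists x, y; split; [assumption|]; split; [assumption|].
    intros s t Hs Ht.
    assert (- phi s t <= m)%R by (apply Hub; exists s, t; auto).
    lra. }
  assert (Hd : forall x y, exists delta : posreal, (a <= x <= b -> a' <= y <= b' ->
    forall s t, Rabs (s - x) < delta -> Rabs (t - y) < delta -> - m + delta < phi s t)%R).
  { intros x y.
    destruct (classic (a <= x <= b /\ a' <= y <= b')%R) as [[Hx Hy]|Hn].
    - specialize (Hgt x y Hx Hy).
      destruct (Hlsc x y ((phi x y + m) / 2)%R Hx Hy ltac:(lra)) as [d [Hd H]].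
      assert (Hmin : (0 < Rmin d ((phi x y + m) / 2))%R) by (apply Rmin_glb_lt; lra).
      exists (mkposreal _ Hmin); intros _ _ s t Hs Ht; cbn [pos] in *.
      pose proof (Rmin_l d ((phi x y + m) / 2)); pose proof (Rmin_r d ((phi x y + m) / 2)).
      specialize (H s t ltac:(lra) ltac:(lra)); lra.
    - exists (mkposreal 1 Rlt_0_1); intros Hx Hy; tauto. }
  (* One gauge plays two roles, radius of the neighborhood and size of the gap, so the uniform lower
     bound from [compactness_value_2d] bounds the gap as well. *)
  set (delta := fun x y => proj1_sig (constructive_indefinite_description _ (Hd x y))).
  assert (Hdelta : forall x y, (a <= x <= b -> a' <= y <= b' ->
    forall s t, Rabs (s - x) < delta x y -> Rabs (t - y) < delta x y -> - m + delta x y < phi s t)%R).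
  { intros x y; unfold delta; destruct constructive_indefinite_description; assumption. }
  destruct (compactness_value_2d a b a' b' delta) as [d Hdd].
  assert (Hm : (m <= m - d)%R).
  { apply Hlub; intros z [x [y [Hx [Hy ->]]]].
    apply NNPP; intros Hz; apply (Hdd x y Hx Hy); intros [u [w [Hu [Hw [H1 [H2 H3]]]]]].
    apply Hz; specialize (Hdelta u w Hu Hw x y H1 H2); lra. }
  pose proof (cond_pos d); lra.
Qed.

Definition in_square (c : C) (rho : R) (z : C) : Prop :=
  (Rabs (Re z - Re c) <= rho /\ Rabs (Im z - Im c) <= rho)%R.

(* The boundary condition makes the minimum of [Cmod (g z - v)] over the square interior. *)
Lemma nonflat_attains (g : C -> C) (c v : C) (rho : R) :
  (0 < rho)%R -> (forall z, in_square c rho z -> nonflat g z) ->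
  (forall z, in_square c rho z -> (rho <= Cmod (z - c))%R -> (Cmod (g c - v) < Cmod (g z - v))%R) ->
  exists z, in_square c rho z /\ g z = v.
Proof.
  intros Hrho Hnf Hbd.
  assert (Hin : forall x y, (Re c - rho <= x <= Re c + rho -> Im c - rho <= y <= Im c + rho ->
    in_square c rho (x, y))%R).
  { intros x y Hx Hy; split; simpl; apply Rabs_le; lra. }
  destruct (lsc_min_rectangle (fun x y => Cmod (g (x, y) - v))
    (Re c - rho) (Re c + rho) (Im c - rho) (Im c + rho)) as [x [y [Hx [Hy Hmin]]]];
    try lra.
  - intros x y; apply Cmod_ge_0.
  - intros x y eps Hx Hy He.
    destruct (nonflat_continuous g (x, y) eps (Hnf _ (Hin x y Hx Hy)) He) as [d [Hd H]].
    exists (d / 2)%R; split; [lra|]; intros s t Hs Ht.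
    specialize (H ((s, t) - (x, y))).
    assert (Est : (x, y) + ((s, t) - (x, y)) = ((s, t) : C)) by (apply Ceq_ReIm; simpl; ring).
    rewrite Est in H.
    assert (Hm : (Cmod ((s, t) - (x, y)) <= d)%R).
    { eapply Rle_trans; [apply Cmod_le_abs|]; simpl.
      unfold Rminus in Hs, Ht; lra. }
    specialize (H Hm).
    pose proof (Cmod_triangle_mid (g (x, y)) (g (s, t)) v) as H1.
    rewrite Cmod_sub_sym in H; lra.
  - set (z := (x, y) : C) in *.
    assert (Hz : in_square c rho z) by (apply Hin; assumption).
    exists z; split; [assumption|]; apply NNPP; intros Hne.
    assert (Hc : (Cmod (g z - v) <= Cmod (g c - v))%R).
    { specialize (Hmin (Re c) (Im c) ltac:(lra) ltac:(lra)).
      rewrite <- surjective_pairing in Hmin; exact Hmin. }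
    assert (Hzc : (Cmod (z - c) < rho)%R).
    { apply Rnot_le_lt; intros Hle; specialize (Hbd z Hz Hle); lra. }
    (* A step shorter than rho - |z - c| stays in the open disk of radius rho, hence in the square,
       where z is a minimum. *)
    destruct (nonflat_descent g z v (rho - Cmod (z - c)) (Hnf z Hz) ltac:(lra) Hne) as [h [Hh Hlt]].
    assert (Hzh : (Cmod (z + h - c) < rho)%R).
    { replace (z + h - c) with ((z - c) + h) by ring.
      eapply Rle_lt_trans; [apply Cmod_triangle|lra]. }
    pose proof (re_le_Cmod (z + h - c)) as H1; pose proof (im_le_Cmod (z + h - c)) as H2.
    unfold Cminus in H1, H2.
    rewrite re_plus, re_opp in H1; rewrite im_plus, im_opp in H2.
    unfold Cminus in Hzh.
    assert (H3 := Rabs_le_between (Re (z + h) + - Re c) rho).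
    assert (H4 := Rabs_le_between (Im (z + h) + - Im c) rho).
    assert (H5 : (Re c - rho <= Re (z + h) <= Re c + rho)%R) by (destruct H3 as [H3 _]; specialize (H3 ltac:(lra)); lra).
    assert (H6 : (Im c - rho <= Im (z + h) <= Im c + rho)%R) by (destruct H4 as [H4 _]; specialize (H4 ltac:(lra)); lra).
    specialize (Hmin (Re (z + h)) (Im (z + h)) H5 H6).
    unfold Re, Im in Hmin; rewrite <- surjective_pairing in Hmin.
    fold z in Hmin; lra.
Qed.

(** * The functions F and G *)

Lemma e_freq (w : C) : e w = Cexp (Ci * RtoC (2 * PI) * w).
Proof. unfold e; f_equal; rewrite RtoC_mult; ring. Qed.

Lemma e_plus (u w : C) : e (u + w) = e u * e w.
Proof. unfold e; rewrite <- Cexp_plus; f_equal; ring. Qed.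

Lemma Re_freq (l : R) (w : C) : Re (Ci * RtoC l * w) = (- (l * Im w))%R.
Proof. destruct w; simpl; ring. Qed.

Lemma Cmod_e (w : C) : Cmod (e w) = exp (- (2 * PI * Im w)).
Proof. rewrite e_freq, Cmod_Cexp, Re_freq; reflexivity. Qed.

Lemma Cmod_e_real (x : R) : Cmod (e (RtoC x)) = 1%R.
Proof. rewrite Cmod_e; simpl; replace (- (2 * PI * 0))%R with 0%R by ring; apply exp_0. Qed.

Lemma e_Lipschitz (u w : C) : (0 <= Im u)%R -> (0 <= Im w)%R ->
  (Cmod (e w - e u) <= 2 * PI * Cmod (w - u))%R.
Proof.
  intros Hu Hw; pose proof PI_RGT_0; rewrite !e_freq.
  eapply Rle_trans; [apply Cexp_Lipschitz; rewrite Re_freq; nra|].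
  replace (Ci * RtoC (2 * PI) * w - Ci * RtoC (2 * PI) * u) with (Ci * RtoC (2 * PI) * (w - u)) by ring.
  rewrite Cmod_mult, Cmod_Ci_RtoC by lra; lra.
Qed.

Lemma e_IZR (n : Z) : e (RtoC (IZR n)) = 1.
Proof.
  assert (Hnat : forall k : nat, cos (2 * PI * INR k) = 1%R /\ sin (2 * PI * INR k) = 0%R).
  { intros k; replace (2 * PI * INR k)%R with (0 + 2 * INR k * PI)%R by ring.
    rewrite cos_period, sin_period, cos_0, sin_0; split; reflexivity. }
  assert (H : cos (2 * PI * IZR n) = 1%R /\ sin (2 * PI * IZR n) = 0%R).
  { destruct (Z_le_gt_dec 0 n) as [Hn|Hn].
    - rewrite <- (Z2Nat.id n Hn), <- INR_IZR_INZ; apply Hnat.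
    - replace (2 * PI * IZR n)%R with (- (2 * PI * INR (Z.to_nat (- n))))%R.
      + rewrite cos_neg, sin_neg; destruct (Hnat (Z.to_nat (- n))) as [-> ->]; split; ring.
      + rewrite INR_IZR_INZ, Z2Nat.id, opp_IZR by lia; ring. }
  rewrite e_freq; destruct (Cexp_ReIm (Ci * RtoC (2 * PI) * RtoC (IZR n))) as [H1 H2].
  assert (E1 : Re (Ci * RtoC (2 * PI) * RtoC (IZR n)) = 0%R) by (simpl; ring).
  assert (E2 : Im (Ci * RtoC (2 * PI) * RtoC (IZR n)) = (2 * PI * IZR n)%R) by (simpl; ring).
  rewrite E1, E2, exp_0 in H1, H2; destruct H as [Hc Hs]; rewrite Hc in H1; rewrite Hs in H2.
  apply Ceq_ReIm; [rewrite H1|rewrite H2]; simpl; ring.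
Qed.

Lemma e_plus_IZR (w : C) (n : Z) : e (w + RtoC (IZR n)) = e w.
Proof. rewrite e_plus, e_IZR; ring. Qed.

Lemma e_conj (x : R) : Cconj (e (RtoC x)) = e (RtoC (- x)).
Proof.
  rewrite !e_freq.
  destruct (Cexp_ReIm (Ci * RtoC (2 * PI) * RtoC x)) as [H1 H2].
  destruct (Cexp_ReIm (Ci * RtoC (2 * PI) * RtoC (- x))) as [H3 H4].
  assert (E1 : forall t, Re (Ci * RtoC (2 * PI) * RtoC t) = 0%R) by (intros; simpl; ring).
  assert (E2 : forall t, Im (Ci * RtoC (2 * PI) * RtoC t) = (2 * PI * t)%R) by (intros; simpl; ring).
  rewrite E1, E2, exp_0 in H1, H2, H3, H4.
  replace (2 * PI * - x)%R with (- (2 * PI * x))%R in H3, H4 by ring.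
  rewrite cos_neg in H3; rewrite sin_neg in H4.
  apply Ceq_ReIm; [rewrite re_conj, H1, H3|rewrite im_conj, H2, H4]; ring.
Qed.

Lemma e_pow (w : C) (n : nat) : e w ^ n = e (RtoC (INR n) * w).
Proof. unfold e; rewrite Cexp_pow; f_equal; ring. Qed.

Lemma lacunary_f_e (w : C) : lacunary_f (e w) = lacunary_F w.
Proof.
  unfold lacunary_f, lacunary_F; f_equal.
  apply functional_extensionality; intros n.
  rewrite e_pow, pow_INR, RtoC_pow; reflexivity.
Qed.

Lemma pow2_C (n : nat) : (2 : C) ^ n = RtoC (2 ^ n).
Proof. rewrite RtoC_pow; reflexivity. Qed.

Lemma pow_two_pos (n : nat) : (0 < 2 ^ n)%R.
Proof. apply pow_lt; lra. Qed.

Lemma div_pow2_C (w : C) (n : nat) : w / 2 ^ n = RtoC (/ 2 ^ n) * w.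
Proof.
  rewrite pow2_C, RtoC_inv by (apply pow_nonzero; lra).
  unfold Cdiv; apply Cmult_comm.
Qed.

Lemma exp_neg_le_inv (x : R) : (0 < x)%R -> (exp (- x) <= / x)%R.
Proof.
  intros Hx; rewrite exp_Ropp; apply Rinv_le_contravar; [assumption|].
  generalize (exp_ineq1 x); lra.
Qed.

Lemma exp_neg_le_sqr (x : R) : (0 < x)%R -> (exp (- x) <= 2 / (x * x))%R.
Proof.
  intros Hx; rewrite exp_Ropp.
  pose proof (exp_term_le_exp x 2 ltac:(lra)) as H; simpl in H.
  replace (2 / (x * x))%R with (/ (x * (x * 1) / (1 + 1)))%R by (field; lra).
  apply Rinv_le_contravar; [|exact H].
  apply Rdiv_lt_0_compat; [nra|lra].
Qed.

(** These data present F and G as exponential sums in an increment h: F(w+h) - F(w) is the sum of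
    [F_coef w n] times exp(i h [F_freq n]) - 1, and likewise for G. The frequencies of G continue
    those of F by halving. *)
Definition F_coef (w : C) (n : nat) : C := e (2 ^ n * w).
Definition F_freq (n : nat) : R := (2 * PI * 2 ^ n)%R.
Definition G_coef (w : C) (n : nat) : C := e (- (1 / 2 ^ S n)) * e (w / 2 ^ S n).
Definition G_freq (n : nat) : R := (2 * PI * / 2 ^ S n)%R.

Lemma F_freq_pos (n : nat) : (0 < F_freq n)%R.
Proof. unfold F_freq; pose proof PI_RGT_0; pose proof (pow_two_pos n); nra. Qed.

Lemma G_freq_pos (n : nat) : (0 < G_freq n)%R.
Proof. unfold G_freq; pose proof PI_RGT_0; pose proof (pow_half_pos (S n)); nra. Qed.

Lemma Cmod_F_coef (w : C) (n : nat) : Cmod (F_coef w n) = exp (- (F_freq n * Im w)).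
Proof.
  unfold F_coef, F_freq; rewrite Cmod_e, pow2_C, im_scal_l; f_equal; ring.
Qed.

Lemma Cmod_G_coef (w : C) (n : nat) : Cmod (G_coef w n) = exp (- (G_freq n * Im w)).
Proof.
  unfold G_coef, G_freq; rewrite Cmod_mult, !div_pow2_C, Cmult_1_r, <- RtoC_opp, Cmod_e_real.
  rewrite Cmod_e, im_scal_l, Rmult_1_l; f_equal; ring.
Qed.

Lemma F_sums (w : C) : (0 < Im w)%R -> csums (F_coef w) (lacunary_F w).
Proof.
  intros Hw; apply (csums_half _ (/ (2 * PI * Im w))); intros n.
  pose proof PI_RGT_0; pose proof (pow_two_pos n).
  rewrite Cmod_F_coef; eapply Rle_trans.
  - apply exp_neg_le_inv, Rmult_lt_0_compat; [apply F_freq_pos|assumption].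
  - right; unfold F_freq; field; repeat split; nra.
Qed.

Lemma G_term_bound (w : C) (l : nat) : (0 <= Im w)%R ->
  (Cmod (e (w / 2 ^ l) - 1) <= 2 * PI * Cmod w * / 2 ^ l)%R.
Proof.
  intros Hw; pose proof PI_RGT_0; pose proof (pow_half_pos l).
  rewrite div_pow2_C, <- (e_IZR 0).
  eapply Rle_trans; [apply e_Lipschitz; [simpl; lra|rewrite im_scal_l; nra]|].
  replace (RtoC (/ 2 ^ l) * w - RtoC (IZR 0)) with (RtoC (/ 2 ^ l) * w) by ring.
  rewrite Cmod_mult, Cmod_R, Rabs_pos_eq by lra; right; ring.
Qed.

Lemma G_sums (w : C) : (0 <= Im w)%R ->
  csums (fun k => e (- (1 / 2 ^ S k)) * (e (w / 2 ^ S k) - 1)) (lacunary_G w).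
Proof.
  intros Hw; apply (csums_half _ (PI * Cmod w)); intros n.
  rewrite Cmod_mult, (div_pow2_C 1), Cmult_1_r, <- RtoC_opp, Cmod_e_real, Rmult_1_l.
  eapply Rle_trans; [apply G_term_bound, Hw|].
  rewrite pow_half_S; right; field; apply pow_nonzero; lra.
Qed.

(** The summability hypothesis of [exp_sum_expansion] with r = Im w / 2. Half of the decay of
    [F_coef] cancels the weight; the other half, through exp(-x) <= 2 / x^2, turns the factor
    [F_freq n] into a multiple of 2^-n. *)
Lemma F_decay (w : C) (n : nat) : (0 < Im w)%R ->
  (Cmod (F_coef w n) * F_freq n * exp (F_freq n * (Im w / 2))
    <= 4 / (PI * (Im w * Im w)) * / 2 ^ n)%R.
Proof.
  intros Hw; pose proof (F_freq_pos n) as Hl.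
  rewrite Cmod_F_coef.
  replace (exp (- (F_freq n * Im w)) * F_freq n * exp (F_freq n * (Im w / 2)))%R with
    (F_freq n * exp (- (F_freq n * (Im w / 2))))%R.
  - eapply Rle_trans; [apply Rmult_le_compat_l; [lra|apply exp_neg_le_sqr; nra]|].
    unfold F_freq; pose proof PI_RGT_0; pose proof (pow_two_pos n).
    right; field; repeat split; lra.
  - replace (exp (- (F_freq n * Im w)))%R with
      (exp (- (F_freq n * (Im w / 2))) * exp (- (F_freq n * (Im w / 2))))%R
      by (rewrite <- exp_plus; f_equal; field).
    rewrite exp_Ropp; field; apply Rgt_not_eq, exp_pos.
Qed.

(** Here the frequencies are bounded, so the weight is bounded too, and the factor [G_freq n] itself
    supplies 2^-n. *)
Lemma G_decay (w : C) (n : nat) : (0 < Im w)%R ->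
  (Cmod (G_coef w n) * G_freq n * exp (G_freq n * (Im w / 2))
    <= PI * exp (2 * PI * (Im w / 2)) * / 2 ^ n)%R.
Proof.
  intros Hw; pose proof (G_freq_pos n) as Hl; pose proof PI_RGT_0.
  pose proof (pow_half_le_1 (S n)); pose proof (pow_half_pos n).
  assert (Hc : (Cmod (G_coef w n) <= 1)%R).
  { rewrite Cmod_G_coef, <- exp_0; apply exp_mono; nra. }
  assert (Hexp : (exp (G_freq n * (Im w / 2)) <= exp (2 * PI * (Im w / 2)))%R).
  { apply exp_mono, Rmult_le_compat_r; [lra|unfold G_freq; nra]. }
  apply Rle_trans with (1 * G_freq n * exp (2 * PI * (Im w / 2)))%R.
  - apply Rmult_le_compat; [|left; apply exp_pos| |exact Hexp].
    + apply Rmult_le_pos; [apply Cmod_ge_0|lra].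
    + apply Rmult_le_compat_r; lra.
  - unfold G_freq; rewrite pow_half_S; right; field; apply pow_nonzero; lra.
Qed.

Lemma F_diff_sums (u h : C) : (0 < Im u)%R -> (0 < Im (u + h))%R ->
  csums (fun n => F_coef u n * (Cexp (Ci * RtoC (F_freq n) * h) - 1))
    (lacunary_F (u + h) - lacunary_F u).
Proof.
  intros Hu Hh; eapply csums_ext; [|apply (csums_minus _ _ _ _ (F_sums _ Hh) (F_sums _ Hu))].
  intros n; unfold F_coef; cbv beta.
  rewrite Cmult_plus_distr_l, e_plus, (e_freq (2 ^ n * h)), pow2_C; unfold F_freq.
  rewrite (RtoC_mult (2 * PI)).
  replace (Ci * (RtoC (2 * PI) * RtoC (2 ^ n)) * h) with (Ci * RtoC (2 * PI) * (RtoC (2 ^ n) * h)) by ring.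
  ring.
Qed.

Lemma G_diff_sums (u h : C) : (0 < Im u)%R -> (0 < Im (u + h))%R ->
  csums (fun n => G_coef u n * (Cexp (Ci * RtoC (G_freq n) * h) - 1))
    (lacunary_G (u + h) - lacunary_G u).
Proof.
  intros Hu Hh; eapply csums_ext;
    [|apply (csums_minus _ _ _ _ (G_sums (u + h) ltac:(lra)) (G_sums u ltac:(lra)))].
  intros n; unfold G_coef; cbv beta.
  rewrite !div_pow2_C, Cmult_plus_distr_l, e_plus, (e_freq (RtoC (/ 2 ^ S n) * h)); unfold G_freq.
  rewrite (RtoC_mult (2 * PI)).
  replace (Ci * (RtoC (2 * PI) * RtoC (/ 2 ^ S n)) * h) with
    (Ci * RtoC (2 * PI) * (RtoC (/ 2 ^ S n) * h)) by ring.
  ring.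
Qed.

(** The term f N outweighs all the others. The terms after N sum to at most |f N| / 4; those before
    N, together with the sum of g, which continues f towards negative indices, also reach at most |f
    N| / 4. *)
Lemma dominant_term (f g : nat -> C) (s t k : C) (N : nat) :
  csums f s -> csums g t -> (Cmod k <= 1)%R -> f N <> 0 ->
  (forall n, (N <= n)%nat -> Cmod (f (S n)) <= Cmod (f n) / 8)%R ->
  (forall n, (n < N)%nat -> Cmod (f n) <= Cmod (f (S n)) / 8)%R ->
  (Cmod (g O) <= Cmod (f O) / 8)%R ->
  (forall n, Cmod (g (S n)) <= Cmod (g n) / 8)%R ->
  s + k * t <> 0.
Proof.
  intros Hf Hg Hk HN Hup Hdown Hg0 HgS E.
  assert (Ht : (Cmod t <= Cmod (f O) / 4)%R).
  { replace (Cmod (f O) / 4)%R with (2 * (Cmod (f O) / 8))%R by field.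
    apply (csums_half_bound g); [assumption|]; intros i.
    induction i as [|i IH]; [simpl; lra|].
    specialize (HgS i); rewrite pow_half_S; pose proof (Cmod_ge_0 (g i)); lra. }
  assert (Hlow : forall n, (n <= N)%nat ->
    (Cmod (csum f n) + Cmod t <= Cmod (f n) / 4)%R).
  { induction n as [|n IH]; intros Hn; [simpl; rewrite Cmod_0; lra|].
    specialize (IH ltac:(lia)); specialize (Hdown n ltac:(lia)).
    simpl csum; pose proof (Cmod_triangle (csum f n) (f n)); pose proof (Cmod_ge_0 (f n)); lra. }
  specialize (Hlow N (le_n _)).
  assert (Htail : (Cmod (s - csum f (S N)) <= Cmod (f N) / 4)%R).
  { replace (Cmod (f N) / 4)%R with (2 * (Cmod (f N) / 8))%R by field.
    apply (csums_half_bound _ _ _ (csums_shift f s (S N) Hf)); intros i.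
    induction i as [|i IH].
    - rewrite Nat.add_0_r; simpl; specialize (Hup N (le_n _)); lra.
    - specialize (Hup (S N + i)%nat ltac:(lia)).
      replace (S N + S i)%nat with (S (S N + i)) by lia.
      rewrite pow_half_S; pose proof (Cmod_ge_0 (f (S N + i)%nat)); lra. }
  assert (Hkt : (Cmod (k * t) <= Cmod t)%R).
  { rewrite Cmod_mult; pose proof (Cmod_ge_0 t); nra. }
  assert (E2 : f N = - ((s - csum f (S N)) + (csum f N + k * t))).
  { simpl csum; replace (- (s - (csum f N + f N) + (csum f N + k * t))) with (f N - (s + k * t)) by ring.
    rewrite E; ring. }
  assert (H : (Cmod (f N) <= Cmod (s - csum f (S N)) + (Cmod (csum f N) + Cmod (k * t)))%R).
  { rewrite E2 at 1; rewrite Cmod_opp.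
    eapply Rle_trans; [apply Cmod_triangle|].
    apply Rplus_le_compat_l, Cmod_triangle. }
  apply Cmod_gt_0 in HN; lra.
Qed.

Lemma pow2_window (E : R) : (8 <= E)%R -> exists j, (8 * 2 ^ j <= E < 16 * 2 ^ j)%R.
Proof.
  intros HE.
  destruct (Pow_x_infinity 2 ltac:(rewrite Rabs_pos_eq; lra) E) as [n Hn].
  specialize (Hn n (le_n _)); rewrite Rabs_pos_eq in Hn by (apply pow_le; lra).
  assert (Hn' : (E < 16 * 2 ^ n)%R) by (pose proof (pow_two_pos n); lra).
  clear Hn; induction n as [|n IH]; [exists O; simpl in *; lra|].
  destruct (Rlt_le_dec E (16 * 2 ^ n)) as [H|H]; [exact (IH H)|].
  exists (S n); split; [simpl; lra|assumption].
Qed.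

Lemma exp_ge_pow2 (n : nat) : (2 ^ n <= exp (INR n))%R.
Proof.
  induction n as [|n IH]; [simpl; rewrite exp_0; lra|].
  rewrite S_INR, exp_plus; simpl; pose proof (exp_ineq1 1 ltac:(lra)).
  pose proof (pow_two_pos n); nra.
Qed.

Lemma Cmod_F_freq_term (w : C) (j n : nat) :
  Cmod (freq_term (F_coef w) F_freq j n) =
  (exp (- (F_freq n * Im w)) * (F_freq n ^ j / INR (fact j)))%R.
Proof.
  unfold freq_term; rewrite Cmod_mult, Cmod_F_coef, Cmod_exp_term, Cmod_Ci_RtoC;
    [reflexivity|left; apply F_freq_pos].
Qed.

Lemma Cmod_G_freq_term (w : C) (j n : nat) :
  Cmod (freq_term (G_coef w) G_freq j n) =
  (exp (- (G_freq n * Im w)) * (G_freq n ^ j / INR (fact j)))%R.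
Proof.
  unfold freq_term; rewrite Cmod_mult, Cmod_G_coef, Cmod_exp_term, Cmod_Ci_RtoC;
    [reflexivity|left; apply G_freq_pos].
Qed.

(** The ratio between the terms at frequencies l / 2 and l. It serves for the terms of F below N,
    for the passage from F to G and for the terms of G. *)
Lemma weight_half (l y : R) (j : nat) :
  (exp (- (l / 2 * y)) * ((l / 2) ^ j / INR (fact j)) =
   exp (- (l * y)) * (l ^ j / INR (fact j)) * (/ 2 ^ j * exp (l * y / 2)))%R.
Proof.
  replace (exp (- (l / 2 * y))) with (exp (- (l * y)) * exp (l * y / 2))%R
    by (rewrite <- exp_plus; f_equal; field).
  replace ((l / 2) ^ j)%R with (l ^ j * / 2 ^ j)%R
    by (unfold Rdiv; rewrite Rpow_mult_distr, pow_inv; reflexivity).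
  field.
  split; [apply pow_nonzero; lra|apply Rgt_not_eq, INR_fact_pos].
Qed.

(* For suitable orders [j] the coefficient is dominated by the single term [n = N],
   around which the moduli [exp (- Y 2^n) 2^(nj)] decay at least geometrically. *)
Lemma coefficient_nonzero (w k : C) : (0 < Im w)%R -> (Cmod k <= 1)%R ->
  exists j, CSeries (freq_term (F_coef w) F_freq (S j)) +
    k * CSeries (freq_term (G_coef w) G_freq (S j)) <> 0.
Proof.
  intros Hw Hk; pose proof PI_RGT_0 as Hpi.
  set (Y := (2 * PI * Im w)%R).
  assert (HY : (0 < Y)%R) by (unfold Y; nra).
  (* From x >= 14 follows exp x >= 2^14, and the choice of j below then forces 2^j > 1024. *)
  assert (HN : exists N, (INR 14 <= Y * 2 ^ N)%R).
  { destruct (Pow_x_infinity 2 ltac:(rewrite Rabs_pos_eq; lra) (INR 14 / Y)) as [N HN].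
    exists N; specialize (HN N (le_n _)); rewrite Rabs_pos_eq in HN by (apply pow_le; lra).
    replace (INR 14) with (Y * (INR 14 / Y))%R by (field; lra); apply Rmult_le_compat_l; lra. }
  destruct HN as [N HN].
  set (x := (Y * 2 ^ N)%R) in *.
  assert (HE : (2 ^ 14 <= exp x)%R).
  { eapply Rle_trans; [apply exp_ge_pow2|apply exp_mono, HN]. }
  (* With 8 * 2^j <= exp x, the ratio 2^j exp(-Y 2^n) of consecutive terms is at most 1/8 from N on.
     With exp x < 16 * 2^j and 2^j > 1024, the opposite ratio, at most 2^-j exp(x/2), is at most 1/8
     below N. *)
  destruct (pow2_window (exp x)) as [j [Hj1 Hj2]]; [simpl in HE; lra|].
  assert (Hj : (1024 < 2 ^ j)%R) by (simpl in HE; lra).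
  assert (Hq : forall z, (z <= x / 2 -> / 2 ^ j * exp z <= / 8)%R).
  { intros z Hz.
    assert (H1 : (exp z <= exp (x / 2))%R) by (apply exp_mono, Hz).
    assert (H2 : (exp (x / 2) * exp (x / 2) = exp x)%R) by (rewrite <- exp_plus; f_equal; field).
    assert (H3 : (exp (x / 2) <= 2 ^ j / 8)%R).
    { apply Rsqr_incr_0_var; [unfold Rsqr; nra|lra]. }
    apply Rle_trans with (/ 2 ^ j * (2 ^ j / 8))%R.
    - apply Rmult_le_compat_l; [apply Rlt_le, pow_half_pos|lra].
    - right; field; lra. }
  assert (Hw8 : forall A z, (0 <= A -> z <= x / 2 -> A * (/ 2 ^ j * exp z) <= A / 8)%R).
  { intros A z HA Hz; specialize (Hq z Hz); unfold Rdiv; apply Rmult_le_compat_l; assumption. }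
  destruct j as [|j]; [simpl in Hj; lra|].
  assert (HpN : forall n, (n <= N)%nat -> (Y * 2 ^ n <= x)%R).
  { intros n Hn; unfold x; apply Rmult_le_compat_l; [lra|apply Rle_pow; [lra|assumption]]. }
  assert (HF : forall n, F_freq (S n) = (2 * F_freq n)%R) by (intros n; unfold F_freq; simpl; ring).
  assert (HY2 : forall n, (F_freq n * Im w = Y * 2 ^ n)%R) by (intros n; unfold F_freq, Y; ring).
  assert (HG : forall n, G_freq (S n) = (G_freq n / 2)%R).
  { intros n; unfold G_freq; rewrite (pow_half_S (S n)); field; apply pow_nonzero; lra. }
  assert (HGY : forall n, (G_freq n * Im w <= Y)%R).
  { intros n; pose proof (pow_half_le_1 (S n)).
    replace (G_freq n * Im w)%R with (Y * / 2 ^ S n)%R by (unfold G_freq, Y; ring); nra. }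
  assert (HxY : (Y <= x)%R) by (specialize (HpN O ltac:(lia)); simpl in HpN; lra).
  exists j.
  apply (dominant_term (freq_term (F_coef w) F_freq (S j)) (freq_term (G_coef w) G_freq (S j)) _ _ _ N);
    try assumption.
  - apply (freq_term_sums _ _ _ (Im w / 2) j ltac:(lra) (fun n => Rlt_le _ _ (F_freq_pos n))
      (fun n => F_decay w n Hw)).
  - apply (freq_term_sums _ _ _ (Im w / 2) j ltac:(lra) (fun n => Rlt_le _ _ (G_freq_pos n))
      (fun n => G_decay w n Hw)).
  - apply Cmod_gt_0; rewrite Cmod_F_freq_term.
    apply Rmult_lt_0_compat; [apply exp_pos|].
    apply Rdiv_lt_0_compat; [apply pow_lt, F_freq_pos|apply INR_fact_pos].
  - intros n Hn; rewrite !Cmod_F_freq_term.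
    replace (exp (- (F_freq (S n) * Im w)) * (F_freq (S n) ^ S j / INR (fact (S j))))%R with
      (exp (- (F_freq n * Im w)) * (F_freq n ^ S j / INR (fact (S j))) *
        (2 ^ S j * exp (- (F_freq n * Im w))))%R.
    + apply Rmult_le_compat_l.
      * apply Rmult_le_pos; [left; apply exp_pos|].
        apply Rlt_le, Rdiv_lt_0_compat; [apply pow_lt, F_freq_pos|apply INR_fact_pos].
      * rewrite HY2.
        assert (Hx : (exp x <= exp (Y * 2 ^ n))%R).
        { apply exp_mono; unfold x; apply Rmult_le_compat_l; [lra|apply Rle_pow; [lra|assumption]]. }
        rewrite exp_Ropp; pose proof (exp_pos (Y * 2 ^ n)) as He.
        apply (Rmult_le_reg_r (exp (Y * 2 ^ n))); [assumption|].
        rewrite Rmult_assoc, Rinv_l by lra; lra.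
    + rewrite HF, Rpow_mult_distr.
      replace (exp (- (2 * F_freq n * Im w))) with
        (exp (- (F_freq n * Im w)) * exp (- (F_freq n * Im w)))%R
        by (rewrite <- exp_plus; f_equal; ring).
      field; apply Rgt_not_eq, INR_fact_pos.
  - intros n Hn; rewrite !Cmod_F_freq_term.
    replace (F_freq n) with (F_freq (S n) / 2)%R by (rewrite HF; field).
    rewrite weight_half; apply Hw8.
    + apply Rmult_le_pos; [left; apply exp_pos|].
      apply Rlt_le, Rdiv_lt_0_compat; [apply pow_lt, F_freq_pos|apply INR_fact_pos].
    + rewrite HY2; specialize (HpN (S n) Hn); lra.
  - rewrite Cmod_F_freq_term, Cmod_G_freq_term.
    (* The first frequency of G is half the first frequency of F, so the same ratio governs the
       passage from one sum to the other. *)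
    replace (G_freq 0) with (F_freq 0 / 2)%R by (unfold F_freq, G_freq; simpl; field).
    rewrite weight_half; apply Hw8.
    + apply Rmult_le_pos; [left; apply exp_pos|].
      apply Rlt_le, Rdiv_lt_0_compat; [apply pow_lt, F_freq_pos|apply INR_fact_pos].
    + rewrite HY2; specialize (HpN O ltac:(lia)); lra.
  - intros n; rewrite !Cmod_G_freq_term, HG, weight_half; apply Hw8.
    + apply Rmult_le_pos; [left; apply exp_pos|].
      apply Rlt_le, Rdiv_lt_0_compat; [apply pow_lt, G_freq_pos|apply INR_fact_pos].
    + specialize (HGY n); lra.
Qed.

(** The parameter k treats two functions at once: k = 1 gives S and k = 0 gives F. *)
Lemma FG_nonflat (k u : C) : (Cmod k <= 1)%R -> (0 < Im u)%R ->
  nonflat (fun w => lacunary_F w + k * lacunary_G w) u.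
Proof.
  intros Hk Hu.
  apply (nonflat_of_expansion _ _ (fun j => CSeries (freq_term (F_coef u) F_freq (S j)) +
    k * CSeries (freq_term (G_coef u) G_freq (S j)))).
  2: { exact (coefficient_nonzero u k Hu Hk). }
  intros p.
  destruct (exp_sum_expansion _ _ _ (Im u / 2) p ltac:(lra) (fun n => Rlt_le _ _ (F_freq_pos n))
    (fun n => F_decay u n Hu)) as [M1 H1].
  destruct (exp_sum_expansion _ _ _ (Im u / 2) p ltac:(lra) (fun n => Rlt_le _ _ (G_freq_pos n))
    (fun n => G_decay u n Hu)) as [M2 H2].
  exists (M1 + Cmod k * M2)%R, (Im u / 2 / 2)%R; split; [lra|]; intros h Hh.
  assert (Huh : (0 < Im (u + h))%R).
  { rewrite im_plus; pose proof (im_le_Cmod h); pose proof (Rabs_maj2 (Im h)); lra. }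
  specialize (H1 h _ Hh (F_diff_sums u h Hu Huh)).
  specialize (H2 h _ Hh (G_diff_sums u h Hu Huh)).
  match type of H1 with (Cmod ?a <= _)%R => match type of H2 with (Cmod ?b <= _)%R =>
    apply Rle_trans with (Cmod (a + k * b)) end end.
  - right; f_equal.
    rewrite (csum_ext (fun j => (CSeries (freq_term (F_coef u) F_freq (S j)) +
      k * CSeries (freq_term (G_coef u) G_freq (S j))) * h ^ S j)
      (fun j => CSeries (freq_term (F_coef u) F_freq (S j)) * h ^ S j +
        k * (CSeries (freq_term (G_coef u) G_freq (S j)) * h ^ S j))) by (intros; ring).
    rewrite csum_plus, csum_scal; ring.
  - eapply Rle_trans; [apply Cmod_triangle|]; rewrite Cmod_mult.
    pose proof (Cmod_ge_0 k); nra.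
Qed.

(** * Words with small exponential sum *)

(** The sum of e(w / 2^l) for 1 <= l <= k, that is, of e along k halvings of w. By [F_descale] it is
    F(w / 2^k) - F(w). *)
Definition sig (k : nat) (w : C) : C := csum (fun i => e (RtoC (/ 2 ^ S i) * w)) k.

Lemma sig_add (k l : nat) (w : C) : sig (k + l) w = sig k w + sig l (RtoC (/ 2 ^ k) * w).
Proof.
  unfold sig; rewrite csum_add; f_equal; apply csum_ext; intros i _.
  rewrite Cmult_assoc, <- RtoC_mult, <- pow_half_add; do 4 f_equal; f_equal; lia.
Qed.

Lemma e_dyadic_period (i k : nat) (b : Z) (w : C) : (i <= k)%nat ->
  e (RtoC (/ 2 ^ i) * (w + RtoC (IZR (2 ^ Z.of_nat k * b)))) = e (RtoC (/ 2 ^ i) * w).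
Proof.
  intros Hi; rewrite <- (e_plus_IZR (RtoC (/ 2 ^ i) * w) (2 ^ Z.of_nat (k - i) * b)); f_equal.
  rewrite Cmult_plus_distr_l, <- RtoC_mult; do 2 f_equal.
  rewrite !mult_IZR, <- !pow_IZR.
  replace k with (i + (k - i))%nat at 1 by lia.
  rewrite pow_add; field; apply pow_nonzero; lra.
Qed.

Lemma sig_period (k : nat) (b : Z) (w : C) :
  sig k (w + RtoC (IZR (2 ^ Z.of_nat k * b))) = sig k w.
Proof.
  apply csum_ext; intros i Hi; apply e_dyadic_period; lia.
Qed.

(** The constant does not depend on k: the Lipschitz constants 2 PI / 2^l of the terms add up to at
    most 2 PI. *)
Lemma sig_Lipschitz (k : nat) (u w : C) : (0 <= Im u)%R -> (0 <= Im w)%R ->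
  (Cmod (sig k w - sig k u) <= 8 * Cmod (w - u))%R.
Proof.
  intros Hu Hw; pose proof PI_RGT_0; pose proof PI_4; pose proof (Cmod_ge_0 (w - u)).
  unfold sig; rewrite <- csum_minus.
  apply Rle_trans with (2 * (PI * Cmod (w - u)))%R; [|nra].
  apply csum_half_bound_weak; [nra|]; intros i _.
  pose proof (pow_half_pos (S i)).
  eapply Rle_trans; [apply e_Lipschitz; rewrite im_scal_l; nra|].
  replace (RtoC (/ 2 ^ S i) * w - RtoC (/ 2 ^ S i) * u) with (RtoC (/ 2 ^ S i) * (w - u)) by ring.
  rewrite Cmod_mult, Cmod_R, Rabs_pos_eq, pow_half_S by lra.
  right; field; apply pow_nonzero; lra.
Qed.

Lemma sig_Lipschitz_real (k : nat) (x y : R) :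
  (Cmod (sig k (RtoC x) - sig k (RtoC y)) <= 8 * Rabs (x - y))%R.
Proof.
  rewrite <- Cmod_R, RtoC_minus; apply sig_Lipschitz; simpl; lra.
Qed.

Lemma sig_conj (k : nat) (x : R) : Cconj (sig k (RtoC x)) = sig k (RtoC (- x)).
Proof.
  unfold sig; rewrite <- csum_conj; apply csum_ext; intros i _.
  rewrite <- !RtoC_mult, e_conj; do 2 f_equal; ring.
Qed.

(** Iteration of the functional equation F(u) = e(u) + F(2u). *)
Lemma F_descale (k : nat) (w : C) : (0 < Im w)%R ->
  lacunary_F (RtoC (/ 2 ^ k) * w) = sig k w + lacunary_F w.
Proof.
  intros Hw; induction k as [|k IH].
  - simpl; rewrite Rinv_1, Cmult_1_l; unfold sig; simpl; ring.
  - set (u := RtoC (/ 2 ^ S k) * w).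
    assert (Hu : (0 < Im u)%R).
    { unfold u; rewrite im_scal_l; pose proof (pow_half_pos (S k)); nra. }
    assert (E : lacunary_F (RtoC (/ 2 ^ k) * w) = lacunary_F u - F_coef u 0).
    { apply CSeries_unique.
      pose proof (csums_shift _ _ 1 (F_sums u Hu)) as H; simpl csum in H.
      replace (lacunary_F u - F_coef u 0) with (lacunary_F u - (0 + F_coef u 0)) by ring.
      eapply csums_ext; [|exact H]; intros n; unfold F_coef, u; simpl Nat.add.
      f_equal; rewrite Cpow_S, pow_half_S.
      replace (RtoC (/ 2 ^ k)) with (RtoC 2 * RtoC (/ 2 ^ k / 2))
        by (rewrite <- RtoC_mult; f_equal; field; apply pow_nonzero; lra).
      ring. }
    rewrite IH in E.
    replace (sig (S k) w) with (sig k w + e u) by reflexivity.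
    replace (lacunary_F u) with (lacunary_F u - F_coef u 0 + F_coef u 0) by ring.
    rewrite <- E; unfold F_coef; simpl Cpow; rewrite Cmult_1_l; ring.
Qed.

(* [loop m eta g]: a word of binary digits, starting (lowest digits first) with [m] ones,
   which leads the point 0 back to within [eta] of 0 under the inverse branches
   [y -> (y + digit) / 2] of angle doubling, with exponential sum within [eta] of [g]. *)
Definition loop (m : nat) (eta : R) (g : C) : Prop :=
  exists (k : nat) (a b : Z), (m <= k)%nat /\ a = (-1 + 2 ^ Z.of_nat m * b)%Z /\
    (Rabs (/ 2 ^ k * IZR a) <= eta)%R /\ (Cmod (sig k (RtoC (IZR a)) - g) <= eta)%R.

Lemma loop_weaken (m : nat) (eta eta' : R) (g g' : C) :
  (eta + Cmod (g - g') <= eta')%R -> loop m eta g -> loop m eta' g'.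
Proof.
  intros H [k [a [b [Hk [Ha [H1 H2]]]]]]; exists k, a, b.
  pose proof (Cmod_ge_0 (g - g')); repeat split; try assumption; [lra|].
  eapply Rle_trans; [apply (Cmod_triangle_mid _ g)|lra].
Qed.

Lemma loop_0 (m : nat) (eta : R) (g : C) : loop m eta g -> loop 0 eta g.
Proof.
  (* For m = 0 the congruence modulo 2^0 = 1 is vacuous. *)
  intros [k [a [b [_ [_ H]]]]]; exists k, a, (a + 1)%Z; repeat split; try apply H; lia.
Qed.

(** The digits of c are placed above those of a, so the m low ones are kept and the first k terms do
    not change. The second word then starts at distance at most eta from its intended start, which
    costs 8 eta by [sig_Lipschitz_real]; adding the error eta of the first sum gives 9 eta. *)
Lemma loop_concat (m : nat) (eta eta' : R) (g g' : C) :
  loop m eta g -> loop 0 eta' g' -> loop m (9 * eta + eta') (g + g').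
Proof.
  intros [k [a [b [Hk [Ha [H1 H2]]]]]] [l [c [_ [_ [_ [H3 H4]]]]]].
  exists (k + l)%nat, (a + 2 ^ Z.of_nat k * c)%Z, (b + 2 ^ Z.of_nat (k - m) * c)%Z.
  pose proof (pow_half_pos k); pose proof (pow_half_pos l).
  assert (Heta : (0 <= eta)%R) by (eapply Rle_trans; [apply Rabs_pos|exact H1]).
  assert (E : (/ 2 ^ k * IZR (a + 2 ^ Z.of_nat k * c) = / 2 ^ k * IZR a + IZR c)%R).
  { rewrite plus_IZR, mult_IZR, <- pow_IZR; field; apply pow_nonzero; lra. }
  repeat split.
  - lia.
  - rewrite Ha, Z.mul_add_distr_l, Z.mul_assoc, <- Z.pow_add_r by lia.
    rewrite <- Nat2Z.inj_add; replace (m + (k - m))%nat with k by lia; ring.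
  - rewrite pow_half_add, (Rmult_comm (/ 2 ^ k)), Rmult_assoc, E, Rmult_plus_distr_l.
    eapply Rle_trans; [apply Rabs_triang|].
    rewrite Rabs_mult, (Rabs_pos_eq (/ 2 ^ l)) by lra.
    pose proof (pow_half_le_1 l); pose proof (Rabs_pos (/ 2 ^ k * IZR a)); nra.
  - rewrite sig_add.
    rewrite plus_IZR, RtoC_plus, sig_period, <- RtoC_plus, <- plus_IZR, <- RtoC_mult, E.
    replace (sig k (RtoC (IZR a)) + sig l (RtoC (/ 2 ^ k * IZR a + IZR c)) - (g + g')) with
      ((sig k (RtoC (IZR a)) - g) + ((sig l (RtoC (/ 2 ^ k * IZR a + IZR c)) - sig l (RtoC (IZR c)))
        + (sig l (RtoC (IZR c)) - g'))) by ring.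
    eapply Rle_trans; [apply Cmod_triangle|].
    pose proof (Cmod_triangle (sig l (RtoC (/ 2 ^ k * IZR a + IZR c)) - sig l (RtoC (IZR c)))
      (sig l (RtoC (IZR c)) - g')).
    pose proof (sig_Lipschitz_real l (/ 2 ^ k * IZR a + IZR c) (IZR c)) as HL.
    replace (/ 2 ^ k * IZR a + IZR c - IZR c)%R with (/ 2 ^ k * IZR a)%R in HL by ring.
    lra.
Qed.

(** Replacing a by -a conjugates every term. The condition on the low digits is not preserved, hence
    m = 0. *)
Lemma loop_conj (eta : R) (g : C) : loop 0 eta g -> loop 0 eta (Cconj g).
Proof.
  intros [k [a [_ [_ [_ [H1 H2]]]]]]; exists k, (- a)%Z, (1 - a)%Z; repeat split.
  - lia.
  - simpl Z.of_nat; rewrite Z.pow_0_r; ring.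
  - rewrite opp_IZR.
    replace (/ 2 ^ k * - IZR a)%R with (- (/ 2 ^ k * IZR a))%R by ring.
    rewrite Rabs_Ropp; exact H1.
  - rewrite opp_IZR, <- sig_conj, <- Cminus_conj, Cmod_conj; exact H2.
Qed.

Lemma loop_nat (t : nat) : loop 0 0 (RtoC (INR t)).
Proof.
  exists t, 0%Z, 1%Z; repeat split.
  - lia.
  - rewrite Rmult_0_r, Rabs_R0; lra.
  - replace (sig t (RtoC (IZR 0))) with (RtoC (INR t)).
    + replace (RtoC (INR t) - RtoC (INR t)) with (RtoC 0) by ring; rewrite Cmod_0; lra.
    + unfold sig; rewrite (csum_ext _ (fun _ => 1)), csum_const; [ring|].
      intros i _; rewrite Cmult_0_r; apply (e_IZR 0).
Qed.

Lemma loop_repeat (n : nat) (eta : R) (g : C) :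
  loop 0 eta g -> loop 0 (9 * INR n * eta) (RtoC (INR n) * g).
Proof.
  intros H; induction n as [|n IH].
  - replace (9 * INR 0 * eta)%R with 0%R by (simpl; ring).
    replace (RtoC (INR 0) * g) with (RtoC (INR 0)) by (simpl; ring); apply loop_nat.
  - rewrite S_INR, RtoC_plus.
    replace (9 * (INR n + 1) * eta)%R with (9 * eta + 9 * INR n * eta)%R by ring.
    replace ((RtoC (INR n) + 1) * g) with (g + RtoC (INR n) * g) by ring.
    apply loop_concat; assumption.
Qed.

(** The integer (4^n - 1) / 3, with binary digits 01 repeated n times. One turn uses the digit 1 and
    then 0, which takes 1/3 to 2/3 and back to 1/3. *)
Fixpoint third_digits (n : nat) : Z :=
  match n with O => 0 | S m => third_digits m + 2 ^ Z.of_nat (2 * m) * 1 end.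

(** The position reached from y after n turns. Each turn is the contraction of ratio 1/4 that fixes
    1/3. *)
Definition third_orbit (y : R) (n : nat) : R := (/ 2 ^ (2 * n) * (y + IZR (third_digits n)))%R.

Lemma third_orbit_eq (y : R) (n : nat) :
  third_orbit y n = (1 / 3 + / 2 ^ (2 * n) * (y - 1 / 3))%R.
Proof.
  unfold third_orbit; induction n as [|n IH]; [simpl; field|].
  simpl third_digits; rewrite plus_IZR, mult_IZR, <- pow_IZR.
  replace (2 * S n)%nat with (S (S (2 * n))) by lia; rewrite !pow_half_S.
  assert (E : (/ 2 ^ (2 * n) * 2 ^ (2 * n) = 1)%R) by (field; apply pow_nonzero; lra).
  match goal with |- ?l = ?r => transitivity
    ((/ 2 ^ (2 * n) * (y + IZR (third_digits n)) + / 2 ^ (2 * n) * 2 ^ (2 * n)) / 4)%R end.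
  - replace (2 * n)%nat with (n + (n + 0))%nat by lia; field; apply pow_nonzero; lra.
  - rewrite IH, E; field; apply pow_nonzero; lra.
Qed.

(** The argument is the periodic point 1/3 with the digit 1 of the turn added; two halvings give 2/3
    and 1/3. *)
Lemma sig_2_third : sig 2 (RtoC (1 / 3 + 1)) = -1.
Proof.
  unfold sig; cbn [csum]; rewrite <- !RtoC_mult.
  replace (/ 2 ^ 1 * (1 / 3 + 1))%R with (- (1 / 3) + IZR 1)%R by (simpl; field).
  rewrite RtoC_plus, e_plus_IZR, <- e_conj.
  replace (/ 2 ^ 2 * (1 / 3 + 1))%R with (1 / 3)%R by (simpl; field).
  set (z := e (RtoC (1 / 3))).
  assert (E : Re z = (- (1 / 2))%R).
  { unfold z; rewrite e_freq.
    destruct (Cexp_ReIm (Ci * RtoC (2 * PI) * RtoC (1 / 3))) as [-> _].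
    replace (Re (Ci * RtoC (2 * PI) * RtoC (1 / 3))) with 0%R by (simpl; ring).
    replace (Im (Ci * RtoC (2 * PI) * RtoC (1 / 3))) with (2 * (PI / 3))%R by (simpl; field).
    rewrite exp_0, cos_2PI3; lra. }
  apply Ceq_ReIm; rewrite ?re_plus, ?im_plus, ?re_conj, ?im_conj; rewrite ?E; simpl; lra.
Qed.

Lemma sig_third_step (y : R) (n : nat) :
  sig (2 * S n) (RtoC (y + IZR (third_digits (S n)))) =
  sig (2 * n) (RtoC (y + IZR (third_digits n))) + sig 2 (RtoC (third_orbit y n + 1)).
Proof.
  replace (2 * S n)%nat with (2 * n + 2)%nat by lia; rewrite sig_add.
  change (third_digits (S n)) with (third_digits n + 2 ^ Z.of_nat (2 * n) * 1)%Z.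
  f_equal.
  - rewrite plus_IZR, <- Rplus_assoc, RtoC_plus, sig_period; reflexivity.
  - rewrite <- RtoC_mult; do 2 f_equal; unfold third_orbit.
    rewrite plus_IZR, mult_IZR, <- pow_IZR; field; apply pow_nonzero; lra.
Qed.

Lemma third_orbit_dist (y : R) (n : nat) : (Rabs y <= 1 ->
  Rabs (third_orbit y n - 1 / 3) <= 2 * / 2 ^ n)%R.
Proof.
  intros Hy; rewrite third_orbit_eq.
  replace (1 / 3 + / 2 ^ (2 * n) * (y - 1 / 3) - 1 / 3)%R with (/ 2 ^ (2 * n) * (y - 1 / 3))%R by ring.
  rewrite Rabs_mult, Rabs_pos_eq by (left; apply pow_half_pos).
  replace (2 * n)%nat with (n + n)%nat by lia; rewrite pow_half_add.
  pose proof (pow_half_pos n); pose proof (pow_half_le_1 n).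
  assert (Rabs (y - 1 / 3) <= 2)%R.
  { apply Rabs_le; apply Rabs_le_between in Hy; lra. }
  pose proof (Rabs_pos (y - 1 / 3)).
  apply Rle_trans with (/ 2 ^ n * 1 * 2)%R; [|lra].
  apply Rmult_le_compat; nra.
Qed.

(* Near the cycle {1/3, 2/3} of angle doubling every extra turn adds about
   [e (1/3) + e (2/3) = -1]. *)
Lemma sig_third_turns (y : R) (q r : nat) : (Rabs y <= 1)%R ->
  (Cmod (sig (2 * (q + r)) (RtoC (y + IZR (third_digits (q + r)))) -
     (sig (2 * q) (RtoC (y + IZR (third_digits q))) - RtoC (INR r)))
   <= 32 * / 2 ^ q * (1 - / 2 ^ r))%R.
Proof.
  intros Hy; induction r as [|r IH].
  - rewrite Nat.add_0_r; simpl INR.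
    match goal with |- (Cmod ?z <= _)%R => replace z with (RtoC 0) by ring end.
    rewrite Cmod_0; simpl; lra.
  - rewrite Nat.add_succ_r, sig_third_step, S_INR, (RtoC_plus (INR r) 1).
    set (A := sig (2 * (q + r)) _) in *; set (B := sig (2 * q) _) in *.
    replace (A + sig 2 (RtoC (third_orbit y (q + r) + 1)) - (B - (RtoC (INR r) + 1))) with
      ((A - (B - RtoC (INR r))) + (sig 2 (RtoC (third_orbit y (q + r) + 1)) - sig 2 (RtoC (1 / 3 + 1))))
      by (rewrite sig_2_third; ring).
    eapply Rle_trans; [apply Cmod_triangle|].
    (* Turn number q + r costs at most 8 times the distance 2 * 2^-(q+r) to the cycle, and these
       costs sum to 32 * 2^-q (1 - 2^-r). *)
    pose proof (sig_Lipschitz_real 2 (third_orbit y (q + r) + 1) (1 / 3 + 1)) as H.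
    replace (third_orbit y (q + r) + 1 - (1 / 3 + 1))%R with (third_orbit y (q + r) - 1 / 3)%R in H by ring.
    pose proof (third_orbit_dist y (q + r) Hy) as H1; rewrite pow_half_add in H1.
    rewrite pow_half_S; lra.
Qed.

(** The word consists of m ones, leading from 0 to -2^-m, then q + r turns, leading close to 1/3,
    then s zeros, leading back to 0. The number g is the sum for r = 0: the r extra turns come when
    the orbit is already near the cycle, so they change the sum by about -r. *)
Lemma loop_base (m : nat) (eta : R) : (0 < eta)%R ->
  exists g, forall r : nat, loop m eta (g - RtoC (INR r)).
Proof.
  intros He.
  (* The extra turns contribute an error 32 * 2^-q and the shifted start of the return another 8 * 4
     * 2^-q, hence eta / 64. The return starts at a point of modulus at most 4, hence eta / 4 for
     2^-s. *)
  destruct (pow_half_small (eta / 64) ltac:(lra)) as [q Hq]; specialize (Hq q (le_n _)).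
  destruct (pow_half_small (eta / 4) ltac:(lra)) as [s Hs]; specialize (Hs s (le_n _)).
  set (y := (- / 2 ^ m)%R).
  assert (Hy : (Rabs y <= 1)%R).
  { unfold y; rewrite Rabs_Ropp, Rabs_pos_eq; [apply pow_half_le_1|left; apply pow_half_pos]. }
  exists (sig m (RtoC (IZR (-1))) + sig (2 * q) (RtoC (y + IZR (third_digits q)))
    + sig s (RtoC (third_orbit y q))).
  intros r; exists (m + 2 * (q + r) + s)%nat,
    (-1 + 2 ^ Z.of_nat m * third_digits (q + r))%Z, (third_digits (q + r)).
  assert (E : (/ 2 ^ m * IZR (-1 + 2 ^ Z.of_nat m * third_digits (q + r)) = y + IZR (third_digits (q + r)))%R).
  { unfold y; rewrite plus_IZR, mult_IZR, <- pow_IZR; field; apply pow_nonzero; lra. }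
  assert (E2 : (/ 2 ^ (m + 2 * (q + r)) * IZR (-1 + 2 ^ Z.of_nat m * third_digits (q + r))
    = third_orbit y (q + r))%R).
  { unfold third_orbit; rewrite <- E, pow_half_add; ring. }
  pose proof (third_orbit_dist y (q + r) Hy) as H1.
  pose proof (third_orbit_dist y q Hy) as H2.
  pose proof (pow_half_le_1 (q + r)); pose proof (pow_half_pos (q + r)).
  pose proof (pow_half_pos q); pose proof (pow_half_pos s).
  repeat split.
  - lia.
  - rewrite pow_half_add, (Rmult_comm (/ 2 ^ (m + 2 * (q + r)))), Rmult_assoc, E2.
    rewrite Rabs_mult, Rabs_pos_eq by lra.
    apply Rle_trans with (/ 2 ^ s * 4)%R; [|lra].
    apply Rmult_le_compat_l; [lra|].
    apply Rabs_le; apply Rabs_le_between in H1; lra.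
  - rewrite sig_add, sig_add, <- !RtoC_mult, E, E2.
    rewrite plus_IZR, RtoC_plus, sig_period.
    pose proof (sig_third_turns y q r Hy) as H5.
    set (A := sig (2 * (q + r)) _) in *; set (B := sig (2 * q) _) in *.
    pose proof (sig_Lipschitz_real s (third_orbit y (q + r)) (third_orbit y q)) as H6.
    set (A' := sig s (RtoC (third_orbit y (q + r)))) in *; set (B' := sig s (RtoC (third_orbit y q))) in *.
    replace (sig m (RtoC (IZR (-1))) + A + A' - (sig m (RtoC (IZR (-1))) + B + B' - RtoC (INR r))) with
      ((A - (B - RtoC (INR r))) + (A' - B')) by ring.
    eapply Rle_trans; [apply Cmod_triangle|].
    assert (H7 : (Rabs (third_orbit y (q + r) - third_orbit y q) <= 4 * / 2 ^ q)%R).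
    { assert (H8 : (/ 2 ^ (q + r) <= / 2 ^ q)%R).
      { rewrite pow_half_add; pose proof (pow_half_le_1 r); nra. }
      apply Rabs_le; apply Rabs_le_between in H1; apply Rabs_le_between in H2; lra. }
    pose proof (pow_half_pos r).
    assert (32 * / 2 ^ q * (1 - / 2 ^ r) <= 32 * / 2 ^ q)%R by nra.
    lra.
Qed.

(** * Dirichlet's theorem and loops with sum close to 0 *)

Lemma pigeonhole (N : nat) (f : nat -> nat) : (forall i, (i <= N)%nat -> (f i < N)%nat) ->
  exists i j, (i < j <= N)%nat /\ f i = f j.
Proof.
  intros Hf; apply NNPP; intros Hno.
  assert (Hnd : NoDup (map f (seq 0 (S N)))).
  { apply NoDup_map_NoDup_ForallPairs; [|apply seq_NoDup].
    intros i j Hi Hj E; apply in_seq in Hi; apply in_seq in Hj.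
    destruct (Nat.lt_trichotomy i j) as [H|[H|H]]; [exfalso|exact H|exfalso];
      apply Hno; [exists i, j|exists j, i]; split; auto; lia. }
  assert (Hincl : incl (map f (seq 0 (S N))) (seq 0 N)).
  { intros x Hx; apply in_map_iff in Hx; destruct Hx as [i [<- Hi]].
    apply in_seq in Hi; apply in_seq; specialize (Hf i ltac:(lia)); lia. }
  pose proof (NoDup_incl_length Hnd Hincl) as H.
  rewrite length_map, !length_seq in H; lia.
Qed.

(** Among the N + 1 fractional parts of i x with 0 <= i <= N, two fall into the same of N intervals
    of length 1 / N. *)
Lemma Dirichlet_approximation (N : nat) (x : R) : (0 < N)%nat ->
  exists (n : nat) (z : Z), (1 <= n <= N)%nat /\ (Rabs (INR n * x - IZR z) <= / INR N)%R.
Proof.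
  intros HN.
  assert (HN0 : (0 < INR N)%R) by (apply lt_0_INR, HN).
  assert (Hpart : forall t, (0 <= t - IZR (Int_part t) < 1)%R).
  { intros t; destruct (base_fp t); unfold frac_part in *; lra. }
  set (f := fun i : nat => (INR N * (INR i * x - IZR (Int_part (INR i * x))))%R).
  assert (Hf : forall i, (0 <= f i < INR N)%R).
  { intros i; unfold f; specialize (Hpart (INR i * x)%R); split; nra. }
  assert (Hz : forall i, (0 <= Int_part (f i))%Z).
  { intros i; apply Z.lt_pred_le, lt_IZR; rewrite <- Z.sub_1_r, minus_IZR.
    specialize (Hf i); specialize (Hpart (f i)); lra. }
  destruct (pigeonhole N (fun i => Z.to_nat (Int_part (f i)))) as [i [j [Hij E]]].
  { intros i _; apply Nat2Z.inj_lt; rewrite Z2Nat.id by apply Hz.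
    apply lt_IZR; rewrite <- INR_IZR_INZ; specialize (Hf i); specialize (Hpart (f i)); lra. }
  apply Z2Nat.inj in E; [|apply Hz|apply Hz].
  exists (j - i)%nat, (Int_part (INR j * x) - Int_part (INR i * x))%Z; split; [lia|].
  rewrite minus_INR, minus_IZR by lia.
  assert (H : (Rabs (f j - f i) <= 1)%R).
  { pose proof (Hpart (f i)); pose proof (Hpart (f j)); rewrite E in *.
    apply Rabs_le; lra. }
  replace ((INR j - INR i) * x - (IZR (Int_part (INR j * x)) - IZR (Int_part (INR i * x))))%R
    with (/ INR N * (f j - f i))%R by (unfold f; field; lra).
  rewrite Rabs_mult, Rabs_pos_eq by (left; apply Rinv_0_lt_compat, HN0).
  rewrite <- (Rmult_1_r (/ INR N)) at 2.
  apply Rmult_le_compat_l; [left; apply Rinv_0_lt_compat, HN0|exact H].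
Qed.

(* [n] loops with sum [g] and [n] conjugate ones have sum [2 n Re g], which is close to an
   integer for some bounded [n]; the integer is removed by turns around {1/3, 2/3}
   (each worth -1) or around 0 (each worth 1). *)
Lemma loop_zero (m : nat) (eps : R) : (0 < eps)%R -> loop m eps 0.
Proof.
  intros He.
  destruct (INR_unbounded (2 / eps)) as [N HN].
  assert (H2e : (0 < 2 / eps)%R) by (apply Rdiv_lt_0_compat; lra).
  assert (HN0 : (0 < N)%nat) by (apply INR_lt; simpl; lra).
  (* The nested concatenations below multiply eta by 9 (9 (9 + 9 n) + 9 (n + 1)) = 810 (n + 1), and
     n + 1 <= N. This uses eps / 2; the other half covers the error 1 / N of Dirichlet's theorem. *)
  set (eta := (eps / (2 * 810 * INR N))%R).
  assert (Heta : (0 < eta)%R) by (apply Rdiv_lt_0_compat; lra).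
  destruct (loop_base m eta Heta) as [g Hg].
  destruct (Dirichlet_approximation N (2 * Re g) HN0) as [[|n] [z [Hn Hz]]]; [lia|].
  assert (Hg0 : loop 0 eta g).
  { apply (loop_0 m); specialize (Hg O); simpl INR in Hg.
    replace g with (g - RtoC 0) by ring; exact Hg. }
  (* The first of the n + 1 loops of sum g carries the m ones and any extra turns. One of
     [Z.to_nat z] and [Z.to_nat (- z)] is 0, so z is cancelled by turns or by steps at 0 according
     to its sign. *)
  pose proof (loop_concat _ _ _ _ _ (loop_concat _ _ _ _ _ (loop_concat _ _ _ _ _
    (Hg (Z.to_nat z)) (loop_repeat n _ _ Hg0)) (loop_repeat (S n) _ _ (loop_conj _ _ Hg0)))
    (loop_nat (Z.to_nat (- z)))) as H.
  apply (loop_weaken _ _ _ _ _) with (2 := H).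
  replace (g - RtoC (INR (Z.to_nat z)) + RtoC (INR n) * g + RtoC (INR (S n)) * Cconj g +
    RtoC (INR (Z.to_nat (- z))) - 0) with (RtoC (INR (S n) * (2 * Re g) - IZR z)).
  - rewrite Cmod_R.
    assert (HnN : (INR (S n) <= INR N)%R) by (apply le_INR; lia).
    assert (H1 : (810 * INR N * eta = eps / 2)%R) by (unfold eta; field; lra).
    assert (H2 : (/ INR N <= eps / 2)%R).
    { replace (eps / 2)%R with (/ (2 / eps))%R by (field; lra).
      apply Rinv_le_contravar; lra. }
    rewrite S_INR in *; pose proof (pos_INR n); nra.
  - assert (Ez : (INR (Z.to_nat (- z)) - INR (Z.to_nat z) = - IZR z)%R).
    { destruct (Z_le_gt_dec 0 z) as [H0|H0].
      - replace (Z.to_nat (- z)) with O by lia.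
        rewrite (INR_IZR_INZ (Z.to_nat z)), Z2Nat.id by lia; simpl; ring.
      - replace (Z.to_nat z) with O by lia.
        rewrite (INR_IZR_INZ (Z.to_nat (- z))), Z2Nat.id, opp_IZR by lia; simpl; ring. }
    assert (Eg : g + Cconj g = RtoC (2 * Re g)).
    { apply Ceq_ReIm; rewrite ?re_plus, ?im_plus, ?re_conj, ?im_conj; simpl; ring. }
    rewrite RtoC_minus, RtoC_mult, <- Eg.
    replace (RtoC (IZR z)) with (- RtoC (- IZR z)) by (rewrite RtoC_opp; ring).
    rewrite <- Ez, RtoC_minus, S_INR, RtoC_plus; ring.
Qed.

(** * Approximation of S and conclusion *)

Lemma nonflat_affine (g : C -> C) (q b u : C) : q <> 0 ->
  nonflat g (q * u + b) -> nonflat (fun w => g (q * w + b)) u.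
Proof.
  intros Hq [p [c [Hp [Hc [M [r [HM [Hr H]]]]]]]].
  assert (Hq0 : (0 < Cmod q)%R) by (apply Cmod_gt_0, Hq).
  exists p, (c * q ^ p); split; [assumption|]; split.
  { apply Cmult_neq_0; [assumption|apply Cpow_nz, Hq]. }
  exists (M * Cmod q ^ S p)%R, (r / Cmod q)%R; repeat split.
  - apply Rmult_le_pos; [assumption|apply pow_le; lra].
  - apply Rdiv_lt_0_compat; assumption.
  - intros h Hh.
    assert (Hqh : (Cmod (q * h) <= r)%R).
    { rewrite Cmod_mult; replace r with (Cmod q * (r / Cmod q))%R by (field; lra).
      apply Rmult_le_compat_l; lra. }
    specialize (H (q * h) Hqh).
    rewrite Cpow_mult_l, Cmod_mult, Rpow_mult_distr in H.
    replace (q * (u + h) + b) with (q * u + b + q * h) by ring.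
    rewrite <- Cmult_assoc, Rmult_assoc; exact H.
Qed.

Lemma nonflat_ext (g g' : C -> C) (u : C) : (forall w, g w = g' w) -> nonflat g u -> nonflat g' u.
Proof.
  intros E [p [c [Hp [Hc [M [r [HM [Hr H]]]]]]]].
  exists p, c; split; [assumption|]; split; [assumption|]; exists M, r.
  split; [assumption|]; split; [assumption|]; intros h Hh; rewrite <- !E; apply H, Hh.
Qed.

(** For rho small the remainder is at most half of the leading term. An annulus is used because the
    points of the square of half-side rho outside the disk of radius rho lie between rho and 2 rho
    from the center. *)
Lemma nonflat_isolated (g : C -> C) (u : C) (R0 : R) : (0 < R0)%R -> nonflat g u ->
  exists rho delta, (0 < rho <= R0 /\ 0 < delta /\ forall h, rho <= Cmod h <= 2 * rho ->
    delta <= Cmod (g (u + h)%C - g u))%R.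
Proof.
  intros HR [p [c [Hp [Hc [M [r [HM [Hr H]]]]]]]].
  assert (Hc0 : (0 < Cmod c)%R) by (apply Cmod_gt_0, Hc).
  set (rho := Rmin R0 (Rmin (r / 2) (Cmod c / (4 * (M + 1))))).
  assert (H1 : (rho <= R0)%R) by apply Rmin_l.
  assert (H2 : (rho <= r / 2)%R) by (eapply Rle_trans; [apply Rmin_r|apply Rmin_l]).
  assert (H3 : (rho <= Cmod c / (4 * (M + 1)))%R) by (eapply Rle_trans; [apply Rmin_r|apply Rmin_r]).
  assert (H0 : (0 < rho)%R).
  { unfold rho; repeat apply Rmin_glb_lt; try lra; apply Rdiv_lt_0_compat; lra. }
  exists rho, (rho ^ p * (Cmod c / 2))%R.
  assert (Hrp : (0 < rho ^ p)%R) by (apply pow_lt, H0).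
  split; [lra|]; split; [apply Rmult_lt_0_compat; lra|]; intros h Hh.
  specialize (H h ltac:(lra)).
  pose proof (Cmod_triangle_sub (g (u + h) - g u) (g (u + h) - g u - c * h ^ p)) as T.
  replace (g (u + h) - g u - (g (u + h) - g u - c * h ^ p)) with (c * h ^ p) in T by ring.
  rewrite Cmod_mult, Cmod_pow in T; simpl pow in H.
  assert (Hpow : (rho ^ p <= Cmod h ^ p)%R) by (apply pow_incr; lra).
  assert (Hs : (M * Cmod h <= Cmod c / 2)%R).
  { apply Rle_trans with ((M + 1) * (2 * (Cmod c / (4 * (M + 1)))))%R.
    - apply Rmult_le_compat; lra.
    - right; field; lra. }
  assert (M * (Cmod h * Cmod h ^ p) <= Cmod c / 2 * Cmod h ^ p)%R.
  { rewrite <- Rmult_assoc; apply Rmult_le_compat_r; lra. }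
  nra.
Qed.

(** By [F_descale], the sum to study is that of e(a/2^l) e(w/2^l), and splitting off e(a/2^l) leaves
    terms e(a/2^l) (e(w/2^l) - 1). For l <= m the congruence turns them into those of G. The
    remaining terms and the tail of G are each at most 2 PI |w| / 2^m, and 4 PI <= 16. *)
Lemma S_approximation (m k : nat) (a b : Z) (w : C) : (0 < Im w)%R ->
  (m <= k)%nat -> a = (-1 + 2 ^ Z.of_nat m * b)%Z ->
  (Cmod (lacunary_F (RtoC (/ 2 ^ k) * (w + RtoC (IZR a))) - lacunary_S w) <=
    16 * Cmod w * / 2 ^ m + Cmod (sig k (RtoC (IZR a))))%R.
Proof.
  intros Hw Hk Ha; pose proof PI_RGT_0; pose proof PI_4; pose proof (Cmod_ge_0 w).
  assert (Hwa : (0 < Im (w + RtoC (IZR a)))%R) by (rewrite im_plus; simpl; lra).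
  rewrite F_descale by assumption.
  assert (EF : lacunary_F (w + RtoC (IZR a)) = lacunary_F w).
  { unfold lacunary_F; f_equal; apply functional_extensionality; intros n.
    rewrite <- (e_plus_IZR (2 ^ n * w) (2 ^ Z.of_nat n * a)); f_equal.
    rewrite mult_IZR, <- pow_IZR, RtoC_mult, pow2_C; ring. }
  rewrite EF; unfold lacunary_S.
  set (t := fun i : nat => e (RtoC (/ 2 ^ S i) * RtoC (IZR a)) * (e (w / 2 ^ S i) - 1)).
  assert (Esig : sig k (w + RtoC (IZR a)) = sig k (RtoC (IZR a)) + csum t k).
  { unfold sig; rewrite <- csum_plus; apply csum_ext; intros i _; unfold t.
    rewrite Cmult_plus_distr_l, e_plus, div_pow2_C; ring. }
  set (T := fun i : nat => e (- (1 / 2 ^ S i)) * (e (w / 2 ^ S i) - 1)).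
  assert (Hbound : forall j i c, Cmod c = 1%R ->
    (Cmod (c * (e (w / 2 ^ S (j + i)) - 1)) <= PI * Cmod w * / 2 ^ j * / 2 ^ i)%R).
  { intros j i c Hc; rewrite Cmod_mult, Hc, Rmult_1_l.
    eapply Rle_trans; [apply G_term_bound; lra|].
    rewrite pow_half_S, pow_half_add; right; field; split; apply pow_nonzero; lra. }
  assert (Et : csum t m = csum T m).
  { apply csum_ext; intros i Hi; unfold t, T; f_equal.
    rewrite Ha, plus_IZR, RtoC_plus, e_dyadic_period by lia.
    f_equal; rewrite div_pow2_C; change (IZR (-1)) with (- (1))%R; rewrite RtoC_opp; ring. }
  replace k with (m + (k - m))%nat in Esig at 3 by lia.
  rewrite csum_add, Et in Esig; rewrite Esig.
  pose proof (G_sums w ltac:(lra)) as HG; fold T in HG.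
  assert (Hfin : (Cmod (csum (fun i => t (m + i)%nat) (k - m)) <= 2 * (PI * Cmod w * / 2 ^ m))%R).
  { pose proof (pow_half_pos m).
    apply csum_half_bound_weak; [apply Rmult_le_pos; nra|]; intros i _; unfold t; apply Hbound.
    rewrite <- RtoC_mult; apply Cmod_e_real. }
  assert (Htail : (Cmod (lacunary_G w - csum T m) <= 2 * (PI * Cmod w * / 2 ^ m))%R).
  { apply (csums_half_bound _ _ _ (csums_shift T _ m HG)); intros i; unfold T; apply Hbound.
    rewrite div_pow2_C, Cmult_1_r, <- RtoC_opp; apply Cmod_e_real. }
  match goal with |- (Cmod ?z <= _)%R => replace z with
    ((csum (fun i => t (m + i)%nat) (k - m) - (lacunary_G w - csum T m)) + sig k (RtoC (IZR a))) by ring end.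
  eapply Rle_trans; [apply Cmod_triangle|].
  apply Rplus_le_compat_r; eapply Rle_trans; [apply Cmod_triangle_sub|].
  pose proof (pow_half_pos m).
  assert (0 <= Cmod w * / 2 ^ m)%R by (apply Rmult_le_pos; lra).
  nra.
Qed.

Lemma value_near_1 (r : R) (v : C) : (0 < r)%R -> image_S v ->
  exists z, unit_disk z /\ open_disk 1 r z /\ lacunary_f z = v.
Proof.
  intros Hr [w0 [Hw0 Hv]]; unfold upper_half_plane in Hw0.
  assert (HS : nonflat lacunary_S w0).
  { apply (nonflat_ext (fun w => lacunary_F w + 1 * lacunary_G w)).
    - intros w; unfold lacunary_S; ring.
    - apply FG_nonflat; [rewrite Cmod_1; lra|assumption]. }
  (* The bound Im w0 / 2 on rho keeps the square around w0 inside the upper half-plane. *)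
  destruct (nonflat_isolated _ _ (Im w0 / 2) ltac:(lra) HS) as [rho [delta [Hrho [Hdelta Hsep]]]].
  set (B := (Cmod w0 + 2 * rho)%R).
  assert (HB : (0 < B)%R) by (unfold B; pose proof (Cmod_ge_0 w0); lra).
  (* The approximation error on the square will be at most 2 eps <= delta / 4. The point (z + a) /
     2^k will have modulus at most 2 eps, so its image under e lies within 4 PI eps <= 16 eps <= r /
     2 of 1. *)
  set (eps := Rmin (delta / 8) (r / 32)).
  assert (He : (0 < eps)%R) by (apply Rmin_glb_lt; lra).
  assert (He1 : (eps <= delta / 8)%R) by apply Rmin_l.
  assert (He2 : (eps <= r / 32)%R) by apply Rmin_r.
  destruct (pow_half_small (eps / (16 * B))) as [m Hm].
  { apply Rdiv_lt_0_compat; lra. }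
  specialize (Hm m (le_n _)).
  assert (HBm : (16 * B * / 2 ^ m <= eps)%R).
  { replace eps with (16 * B * (eps / (16 * B)))%R by (field; lra).
    apply Rmult_le_compat_l; lra. }
  destruct (loop_zero m eps He) as [k [a [b [Hk [Ha [Hy Hs]]]]]].
  replace (sig k (RtoC (IZR a)) - 0) with (sig k (RtoC (IZR a))) in Hs by ring.
  pose proof (pow_half_pos k); pose proof (pow_half_pos m).
  set (q := RtoC (/ 2 ^ k)).
  assert (Hsq : forall z, in_square w0 rho z -> (0 < Im z)%R /\ (Cmod (z - w0) <= 2 * rho)%R /\ (Cmod z <= B)%R).
  { intros z [H1 H2].
    assert (H3 : (Cmod (z - w0) <= 2 * rho)%R).
    { eapply Rle_trans; [apply Cmod_le_abs|].
      unfold Cminus; rewrite re_plus, im_plus, re_opp, im_opp; unfold Rminus in H1, H2; lra. }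
    split; [|split].
    - apply Rabs_le_between in H2; lra.
    - exact H3.
    - replace z with (w0 + (z - w0)) by ring.
      eapply Rle_trans; [apply Cmod_triangle|unfold B; lra]. }
  set (g := fun w => lacunary_F (q * w + q * RtoC (IZR a))).
  assert (Hg : forall z, in_square w0 rho z -> (Cmod (g z - lacunary_S z) <= delta / 4)%R).
  { intros z Hz; destruct (Hsq z Hz) as [Hz1 [Hz2 Hz3]].
    unfold g; rewrite <- Cmult_plus_distr_l.
    eapply Rle_trans; [apply (S_approximation m k a b z Hz1 Hk Ha)|].
    assert (16 * Cmod z * / 2 ^ m <= 16 * B * / 2 ^ m)%R by (apply Rmult_le_compat_r; lra).
    lra. }
  assert (Hq : forall z, Im (q * z + q * RtoC (IZR a)) = (/ 2 ^ k * Im z)%R).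
  { intros z; unfold q; rewrite im_plus, !im_scal_l; simpl; ring. }
  destruct (nonflat_attains g w0 v rho) as [z [Hz Hgz]]; [lra| | |].
  - intros z Hz; destruct (Hsq z Hz) as [Hz1 _].
    apply (nonflat_affine lacunary_F).
    + intros E; apply RtoC_inj in E; lra.
    + apply (nonflat_ext (fun w => lacunary_F w + 0 * lacunary_G w)); [intros; ring|].
      apply FG_nonflat; [rewrite Cmod_0; lra|].
      rewrite Hq; apply Rmult_lt_0_compat; assumption.
  (* Away from the center S differs from v by at least delta, so g differs from v by at least 3
     delta / 4, while at w0 the difference is at most delta / 4. *)
  - intros z Hz Hd; destruct (Hsq z Hz) as [Hz1 [Hz2 Hz3]].
    assert (Hc : in_square w0 rho w0).
    { split; rewrite Rminus_diag, Rabs_R0; lra. }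
    specialize (Hsep (z - w0) ltac:(lra)).
    replace (w0 + (z - w0)) with z in Hsep by ring.
    pose proof (Hg w0 Hc) as G0; pose proof (Hg z Hz) as G1.
    rewrite <- Hv in Hsep, G0.
    pose proof (Cmod_triangle_mid (lacunary_S z) (g z) v).
    rewrite Cmod_sub_sym in G1; lra.
  - destruct (Hsq z Hz) as [Hz1 [Hz2 Hz3]].
    exists (e (q * z + q * RtoC (IZR a))); split; [|split].
    + unfold unit_disk; rewrite Cmod_e, Hq, <- exp_0; apply exp_increasing.
      pose proof PI_RGT_0; assert (0 < / 2 ^ k * Im z)%R by (apply Rmult_lt_0_compat; assumption).
      nra.
    + unfold open_disk; rewrite <- (e_IZR 0).
      eapply Rle_lt_trans; [apply e_Lipschitz; [simpl; lra|rewrite Hq; apply Rmult_le_pos; lra]|].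
      replace (q * z + q * RtoC (IZR a) - RtoC (IZR 0)) with (q * z + q * RtoC (IZR a)) by ring.
      assert (Hn : (Cmod (q * z + q * RtoC (IZR a)) <= 2 * eps)%R).
      { eapply Rle_trans; [apply Cmod_triangle|].
        unfold q; rewrite <- RtoC_mult, Cmod_mult, !Cmod_R, Rabs_pos_eq by lra.
        assert (Hkm : (/ 2 ^ k <= / 2 ^ m)%R).
        { apply Rinv_le_contravar; [apply pow_two_pos|apply Rle_pow; [lra|exact Hk]]. }
        assert (/ 2 ^ k * Cmod z <= / 2 ^ m * B)%R.
        { apply Rmult_le_compat; try lra; apply Cmod_ge_0. }
        nra. }
      pose proof PI_RGT_0; pose proof PI_4; nra.
    + rewrite lacunary_f_e; exact Hgz.
Qed.

(** A finite list misses a small punctured disk around 1, so a solution in every disk centered at 1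
    already gives infinitely many. *)
Lemma list_distance_to_1 (s : list C) :
  exists r, (0 < r)%R /\ forall z, In z s -> z <> 1 -> (r <= Cmod (z - 1))%R.
Proof.
  induction s as [|x s [r [Hr H]]].
  - exists 1%R; split; [lra|intros z []].
  - destruct (Ceq_dec x 1) as [Hx|Hx].
    + exists r; split; [assumption|]; intros z [E|Hz] Hne; [congruence|auto].
    + exists (Rmin r (Cmod (x - 1))); split.
      * apply Rmin_glb_lt; [assumption|apply Cmod_gt_0, Cminus_eq_contra, Hx].
      * intros z [<-|Hz] Hne; [apply Rmin_r|].
        eapply Rle_trans; [apply Rmin_l|auto].
Qed.

Theorem proposition1p1 :
  forall r : R, (0 < r)%R ->
  forall v : C, image_S v ->
  infinite_set (fun z : C => unit_disk z /\ open_disk 1 r z /\ lacunary_f z = v).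
Proof.
  intros r Hr v Hv [s Hs].
  destruct (list_distance_to_1 s) as [d [Hd Hsd]].
  destruct (value_near_1 (Rmin r d) v) as [z [Hz1 [Hz2 Hz3]]]; [apply Rmin_glb_lt; assumption|assumption|].
  unfold unit_disk, open_disk in *.
  pose proof (Rmin_l r d); pose proof (Rmin_r r d).
  assert (Hin : In z s) by (apply Hs; repeat split; [assumption|lra|assumption]).
  (* The point 1 lies on the unit circle, hence outside D. *)
  assert (Hne : z <> 1) by (intros ->; rewrite Cmod_1 in Hz1; lra).
  specialize (Hsd z Hin Hne); lra.
Qed.
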